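(* For every $n\ge 1$ the following assertions are equivalent: (a) (Fishburn) every peak-pit Condorcet domain $\mathcal D\subseteq\mathcal L([n])$ satisfies $|\mathcal D|\le\Phi(n)$; (b) (Galambos and Reiner) every GR-domain $\mathcal D\subseteq\mathcal L([n])$ satisfies $|\mathcal D|\le\Phi(n)$; (c) (Monjardet) every connected Condorcet domain $\mathcal D\subseteq\mathcal L([n])$ satisfies $|\mathcal D|\le\Phi(n)$; (d) $\gamma_n=\Phi(n)$, where $\gamma_n$ is the maximum possible size of a tiling Condorcet domain in $\mathcal L([n])$.
   Context: Linear orders. $[n]=\{1,\dots,n\}$; $\mathcal L([n])$ is the set of linear orders on $[n]$, a linear order $x_1<\dots<x_n$ being encoded by the word $x_1\dots x_n$ ($x_1$ least/worst, $x_n$ greatest/best). $\alpha=12\dots n$, $\omega=n(n-1)\dots1$. $Inv(\sigma)=\{(i,j): i<j,\ j<_\sigma i\}$. The weak Bruhat order is $\sigma\ll\tau\iff Inv(\sigma)\subseteq Inv(\tau)$; $\tau$ covers $\sigma$ iff $Inv(\tau)$ is $Inv(\sigma)$ plus exactly one inversion. The Bruhat graph is the undirected graph on $\mathcal L([n])$ joining $\sigma$ and $\tau$ when one covers the other. Domains. All domains considered contain both $\alpha$ and $\omega$. A domain $\mathcal D\subseteq\mathcal L([n])$ is a Condorcet domain if there are no three elements $i,j,k$ and three linear orders in $\mathcal D$ whose restrictions to $\{i,j,k\}$ are of the form $\{ijk,jki,kij\}$ or $\{kji,jik,ikj\}$. For a triple $i<j<k$, a set of linear orders satisfies the peak condition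 if $j$ is never the least element in the restrictions to $\{i,j,k\}$ (restrictions lie in $\{ijk,ikj,kij,kji\}$), and the pit condition if $j$ is never the greatest (restrictions lie in $\{ijk,jik,jki,kji\}$). A peak-pit domain is a domain satisfying, for each triple $i<j<k$, the peak condition or the pit condition; such a domain is automatically a Condorcet domain. A Condorcet domain is connected if it induces a connected subgraph of the Bruhat graph. GR-domains. Regard maximal chains of the poset $(\mathcal L([n]),\ll)$ as reduced decompositions of the longest permutation $\omega$ into standard transpositions $s_1,\dots,s_{n-1}$. Two maximal chains are equivalent if one reduced decomposition can be obtained from the other by a sequence of replacements of a fragment $s_is_j$ with $|i-j|>1$ by $s_js_i$. A GR-domain is the union of all maximal chains (as sets of linear orders) in one equivalence class. Fishburn's number. $\Phi(n)$ is the number of linear orders $\sigma\in\mathcal L([n])$ such that, for each triple $i<j<k$ in $[n]$, $\sigma$ satisfies the peak condition ($j$ is not the least of $i,j,k$ in $\sigma$) if $j$ is even and the pit condition ($j$ is not the greatest of $i,j,k$ in $\sigma$) if $j$ is odd. Tiling Condorcet domains. In the upper half-plane $\mathbb R\times\mathbb R_{>0}$ fix $n$ vectors $\xi_1,\dots,\xi_n$ of the same length and with distinct directions, going in this order clockwise around $(0,0)$. The zonogon is $Z_n=\{\sum_i a_i\xi_i: 0\le a_i\le 1\}$; its bottom vertex is $(0,0)$ and its top vertex is $\xi_1+\dots+\xi_n$. For $i<j$, an $ij$-tile is a translate of $[0,\xi_i]+[0,\xi_j]$. A rhombus tiling $T$ of $Z_n$ is a subdivision of $Z_n$ into tiles in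 which any two intersecting tiles meet in a single vertex or a single closed edge. $G_T$ is the directed graph of vertices and edges of the tiles, edges directed upward; an edge that is a translate of $[0,\xi_i]$ has color $i$. (For $n=1$, $Z_1=[0,\xi_1]$ and $G_T$ is a single edge.) A snake is a directed path in $G_T$ from the bottom to the top vertex; each snake is known to have exactly one edge of each color, so the colors along it from bottom to top form a linear order on $[n]$ (first color least). $\Sigma(T)$ is the set of linear orders so obtained, and a tiling Condorcet domain is a set of the form $\Sigma(T)$. *)

(* Defs.v *)
From Stdlib Require Export Relation_Operators.
From HB Require Export structures.
From mathcomp Require Export all_boot all_order all_fingroup all_algebra.
From mathcomp Require Export boolp classical_sets reals.

Set Implicit Arguments.
Unset Strict Implicit.
Unset Printing Implicit Defensive.

Import Order.TTheory GRing.Theory Num.Theory.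
Local Open Scope ring_scope.

(* The element [e] of {1, ..., n} is the ordinal of value
    [e - 1], and [s : 'S_n] stands for the linear order whose word is
    [s 0, s 1, ..., s (n - 1)], least element first. *)

Definition before n (s : 'S_n) (i j : 'I_n) : bool :=
  ((s^-1)%g i < (s^-1)%g j)%N.

Definition alpha n : 'S_n := 1%g.
Definition omega n : 'S_n := perm (@rev_ord_inj n).

Definition Inv n (s : 'S_n) : {set 'I_n * 'I_n} :=
  [set p : 'I_n * 'I_n | (p.1 < p.2)%N && before s p.2 p.1].

Definition weak_le n (s t : 'S_n) : bool := Inv s \subset Inv t.

Definition covers n (t s : 'S_n) : bool :=
  weak_le s t && (#|Inv t :\: Inv s| == 1%N).

Definition bruhat_adj n (s t : 'S_n) : bool := covers t s || covers s t.

Definition is_domain n (D : {set 'S_n}) : Prop :=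
  alpha n \in D /\ omega n \in D.

(* The restriction of [s] to {a, b, c} is the word abc. *)
Definition restricts n (s : 'S_n) (a b c : 'I_n) : bool :=
  before s a b && before s b c.

Definition condorcet n (D : {set 'S_n}) : Prop :=
  is_domain D /\
  ~ exists i j k : 'I_n, [/\ i != j, j != k & i != k] /\
    exists s t u : 'S_n, [/\ s \in D, t \in D & u \in D] /\
      ([/\ restricts s i j k, restricts t j k i & restricts u k i j] \/
       [/\ restricts s k j i, restricts t j i k & restricts u i k j]).

Definition peak_at n (s : 'S_n) (i j k : 'I_n) : bool :=
  ~~ (before s j i && before s j k).

Definition pit_at n (s : 'S_n) (i j k : 'I_n) : bool :=
  ~~ (before s i j && before s k j).

Definition peak_pit n (D : {set 'S_n}) : Prop :=
  is_domain D /\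
  forall i j k : 'I_n, (i < j < k)%N ->
    (forall s, s \in D -> peak_at s i j k) \/
    (forall s, s \in D -> pit_at s i j k).

Definition connected_domain n (D : {set 'S_n}) : Prop :=
  forall s t, s \in D -> t \in D ->
    connect [rel x y | [&& x \in D, y \in D & bruhat_adj x y]] s t.

Definition maximal_chain n (C : {set 'S_n}) : bool :=
  maxset (fun B : {set 'S_n} =>
    [forall s in B, forall t in B, weak_le s t || weak_le t s]) C.

(* The letter [k : 'I_n.-1] denotes the transposition of the consecutive
   ordinals [k] and [k + 1]. *)
Definition std_transp n (k : 'I_n.-1) : 'S_n :=
  let i := widen_ord (leq_pred n) k in tperm i (ordS i).

(* Permutations compose from left to right in the library, hence
   [std_transp k * s] is the word [s] with its letters at positions [k] and
   [k + 1] exchanged. *)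
Definition word_perm n (w : seq 'I_n.-1) : 'S_n :=
  foldl (fun s k => (std_transp k * s)%g) 1%g w.

Definition reduced_decomposition n (w : seq 'I_n.-1) : Prop :=
  word_perm w = omega n /\
  forall w', word_perm w' = omega n -> (size w <= size w')%N.

Definition chain_of_word n (w : seq 'I_n.-1) : {set 'S_n} :=
  [set word_perm (take m w) | m : 'I_(size w).+1].

Definition commutation_move m (w w' : seq 'I_m) : Prop :=
  exists (u v : seq 'I_m) (i j : 'I_m),
    [/\ (i.+1 < j)%N || (j.+1 < i)%N,
        w = u ++ [:: i; j] ++ v & w' = u ++ [:: j; i] ++ v].

Definition chain_equiv n (C C' : {set 'S_n}) : Prop :=
  exists w w' : seq 'I_n.-1,
    [/\ reduced_decomposition w, reduced_decomposition w',
        C = chain_of_word w, C' = chain_of_word w'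
      & clos_refl_trans _ (@commutation_move n.-1) w w'].

Definition GR_domain n (D : {set 'S_n}) : Prop :=
  exists C0 : {set 'S_n}, maximal_chain C0 /\
    forall s, s \in D <->
      exists C : {set 'S_n}, [/\ maximal_chain C, chain_equiv C0 C & s \in C].

(* The element of {1, ..., n} encoded by the ordinal [j]
    is [j.+1], whose parity is the relevant one. *)

Definition Phi n : nat :=
  #|[set s : 'S_n | [forall i : 'I_n, forall j : 'I_n, forall k : 'I_n,
       (i < j < k)%N ==>
       if odd j.+1 then pit_at s i j k else peak_at s i j k]]|.

Definition vec_length (R : realType) (v : 'rV[R]_2) : R :=
  Num.sqrt (v 0 0 ^+ 2 + v 0 1 ^+ 2).

(* For vectors of the open upper half-plane, the direction of [w] is obtained
   from that of [v] by turning clockwise iff the determinant of (v, w) is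
   negative. *)
Definition zonogon_vectors (R : realType) n (xi : 'I_n -> 'rV[R]_2) : Prop :=
  [/\ forall i, 0 < xi i 0 1,
      forall i j, vec_length (xi i) = vec_length (xi j)
    & forall i j : 'I_n, (i < j)%N ->
        xi i 0 0 * xi j 0 1 - xi i 0 1 * xi j 0 0 < 0].

Definition zonogon (R : realType) n (xi : 'I_n -> 'rV[R]_2) :
    set 'rV[R]_2 :=
  fun p => exists a : 'I_n -> R,
    (forall i, 0 <= a i <= 1) /\ p = \sum_i a i *: xi i.

Definition top_vertex (R : realType) n (xi : 'I_n -> 'rV[R]_2) : 'rV[R]_2 :=
  \sum_i xi i.

(* [(p, i)] is the edge of color [i] directed from [p] to [p + xi i]. *)
Definition edge (R : realType) n : Type := ('rV[R]_2 * 'I_n)%type.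

Definition edge_set (R : realType) n (xi : 'I_n -> 'rV[R]_2)
    (e : edge R n) : set 'rV[R]_2 :=
  fun q => exists a : R, 0 <= a <= 1 /\ q = e.1 + a *: xi e.2.

(* [(p, i, j)] is the translate by [p] of [0, xi i] + [0, xi j]. *)
Definition tile (R : realType) n : Type := ('rV[R]_2 * 'I_n * 'I_n)%type.

Definition tile_set (R : realType) n (xi : 'I_n -> 'rV[R]_2)
    (t : tile R n) : set 'rV[R]_2 :=
  let: (p, i, j) := t in
  fun q => exists a b : R,
    [/\ 0 <= a <= 1, 0 <= b <= 1 & q = p + a *: xi i + b *: xi j].

Definition tile_vertices (R : realType) n (xi : 'I_n -> 'rV[R]_2)
    (t : tile R n) : seq 'rV[R]_2 :=
  let: (p, i, j) := t in [:: p; p + xi i; p + xi j; p + xi i + xi j].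

Definition tile_edges (R : realType) n (xi : 'I_n -> 'rV[R]_2)
    (t : tile R n) : seq (edge R n) :=
  let: (p, i, j) := t in
  [:: (p, i); (p, j); (p + xi i, j); (p + xi j, i)].

Definition meet_properly (R : realType) n (xi : 'I_n -> 'rV[R]_2)
    (t t' : tile R n) : Prop :=
  (exists v, [/\ v \in tile_vertices xi t, v \in tile_vertices xi t'
    & (tile_set xi t `&` tile_set xi t' = [set v])%classic]) \/
  (exists e, [/\ e \in tile_edges xi t, e \in tile_edges xi t'
    & (tile_set xi t `&` tile_set xi t' = edge_set xi e)%classic]).

(* A tiling is a finite family of tiles, given by a list in which order and
   repetitions are irrelevant. For [n = 1] the zonogon is a segment and there
   is no tile at all. *)
Definition rhombus_tiling (R : realType) n (xi : 'I_n -> 'rV[R]_2)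
    (T : seq (tile R n)) : Prop :=
  [/\ forall p i j, (p, i, j) \in T -> (i < j)%N,
      n <> 1%N -> forall q : 'rV[R]_2,
        zonogon xi q <-> exists2 t, t \in T & tile_set xi t q
    & forall t t', t \in T -> t' \in T -> t != t' ->
        (tile_set xi t `&` tile_set xi t' !=set0)%classic ->
        meet_properly xi t t'].

(* Edge relation of the directed graph of the tiling; for [n = 1] this graph
   is the single edge from the bottom to the top vertex. *)
Definition graph_edge (R : realType) n (xi : 'I_n -> 'rV[R]_2)
    (T : seq (tile R n)) (e : edge R n) : Prop :=
  (exists2 t, t \in T & e \in tile_edges xi t) \/ (n = 1%N /\ e.1 = 0).

Fixpoint directed_path (R : realType) n (xi : 'I_n -> 'rV[R]_2)
    (T : seq (tile R n)) (p q : 'rV[R]_2)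
    (es : seq (edge R n)) : Prop :=
  if es is e :: es' then
    [/\ graph_edge xi T e, e.1 = p
      & directed_path xi T (e.1 + xi e.2) q es']
  else p = q.

Definition snake (R : realType) n (xi : 'I_n -> 'rV[R]_2)
    (T : seq (tile R n)) (es : seq (edge R n)) : Prop :=
  directed_path xi T 0 (top_vertex xi) es.

Definition Sigma (R : realType) n (xi : 'I_n -> 'rV[R]_2)
    (T : seq (tile R n)) (s : 'S_n) : Prop :=
  exists es, snake xi T es /\
    [seq e.2 | e <- es] = [seq s k | k <- enum 'I_n].

Definition tiling_domain (R : realType) n (xi : 'I_n -> 'rV[R]_2)
    (D : {set 'S_n}) : Prop :=
  exists T, rhombus_tiling xi T /\ forall s, s \in D <-> Sigma xi T s.

Definition gamma (R : realType) n (xi : 'I_n -> 'rV[R]_2) : nat :=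
  \max_(D : {set 'S_n} | `[< tiling_domain xi D >]) #|D|.

(* Main.v *)
Require Import Defs.
From mathcomp Require Import zify ring lra.

Set Implicit Arguments.
Unset Strict Implicit.
Unset Printing Implicit Defensive.

(** The four families of domains are compared through a purely combinatorial
    object, a ranking. Call a pair of elements inverted in an order when the
    order exchanges them. A ranking gives every pair a rank, as if the pairs
    were inverted one after another at these times; it is admissible when on
    every triple i < j < k the three pairs come in the order ij, ik, jk or in
    the order jk, ik, ij. The orders that invert, among any three elements,
    an initial part of this sequence are said to conform to the ranking: on
    the triple they satisfy the pit condition in the first case and the peak
    condition in the second, and every order with these properties conforms.

    The key result is [separated_ranking]: every peak-pit family conforms to
    some admissible ranking. It is proved by adding the elements one at a
    time. When m is added, some pairs below m are forced to be inverted before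
    m passes and some are forced to be inverted after m passes; the point is
    that no chain of smaller-to-larger ranks leads from a pair of the second
    sort to a pair of the first, because such a chain can always be shortened
    to a single step ([late_pair_step]). Hence m can be inserted.

    All orders conforming to one ranking lie together in a domain of each of
    the four kinds. Inverting the pairs one by one gives words from the identity to
    the reversed order; two such words differ by exchanges of distant letters
    ([climb_unique]), so the conforming orders lie in one GR-domain
    ([conforms_GR_domain]) and are connected ([conforms_connected]). Placing
    the ij-tile where i and j cross at their rank gives a rhombus tiling having
    all conforming orders among its snakes ([conforms_tiling_domain]).

    Conversely each kind of domain is peak-pit. In a maximal chain no triple
    can show both an order whose middle element is least and one where it is
    greatest, and commutation moves preserve this ([GR_domain_separated]). A
    path from the identity to its reverse inside a connected Condorcet domain
    must exchange the outer elements of each triple, which fixes the side of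
    the triple ([connected_condorcet_separated]). In a tiling, every snake can
    be pushed to the right across tiles until it is the right boundary
    ([right_flip]), and the tiles of color j that it meets form the end of a
    fixed strip ([snake_strip]), so that two snakes cannot disagree on which of
    the ij-tile and the jk-tile comes first ([tiling_separated]).

    Therefore the largest sizes of the four kinds of domains coincide, and as
    the Fishburn domain is peak-pit this common maximum is at least Phi. *)

(** * Inversions and never conditions *)

Section Orders.
Variable n : nat.
Implicit Types (s t u : 'S_n) (x y z i j k a b : 'I_n).

Lemma before_irr s x : before s x x = false.
Proof. by rewrite /before ltnn. Qed.

Lemma before_trans s x y z : before s x y -> before s y z -> before s x z.
Proof. exact: ltn_trans. Qed.

Lemma beforeN s x y : x != y -> before s y x = ~~ before s x y.
Proof.
move=> nxy; have : (s^-1)%g x != (s^-1)%g y by rewrite (inj_eq perm_inj).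
by rewrite /before -val_eqE /=; lia.
Qed.

(** For unordered pairs: symmetric in the two elements as soon as they are
    distinct, which spares sorting them. *)
Definition inverted s x y := (x < y)%N (+) before s x y.

Lemma invertedC s x y : x != y -> inverted s x y = inverted s y x.
Proof.
move=> nxy; rewrite /inverted (beforeN _ nxy).
have : (y < x)%N = ~~ (x < y)%N.
  by move: nxy; rewrite -val_eqE /=; lia.
by move=> ->; case: (x < y)%N; case: (before s x y).
Qed.

Lemma mem_Inv s x y : ((x, y) \in Inv s) = (x < y)%N && inverted s x y.
Proof.
rewrite inE /= /inverted; case: ltnP => //= lxy.
by apply: beforeN; rewrite neq_ltn lxy.
Qed.

Lemma before_inv s x y : before s x y = (x < y)%N (+) inverted s x y.
Proof. by rewrite /inverted; case: (x < y)%N; case: before. Qed.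

Lemma before1 x y : before (1%g : 'S_n) x y = (x < y)%N.
Proof. by rewrite /before invg1 !perm1. Qed.

Lemma inverted1 x y : inverted 1%g x y = false.
Proof. by rewrite /inverted before1 addbb. Qed.

Lemma omegaV : ((omega n)^-1)%g = omega n.
Proof.
apply: (mulgI (omega n)); rewrite mulgV; apply/permP => x.
by rewrite permM !permE rev_ordK.
Qed.

Lemma before_omega x y : before (omega n) x y = (y < x)%N.
Proof.
rewrite /before omegaV !permE /=.
by have := ltn_ord x; have := ltn_ord y; lia.
Qed.

Lemma inverted_omega x y : x != y -> inverted (omega n) x y.
Proof. by move=> nxy; rewrite /inverted before_omega; case: ltngtP nxy => // /val_inj->; rewrite eqxx. Qed.

Lemma card_before s x : #|[set y | before s y x]| = (s^-1)%g x.
Proof.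
have -> : [set y | before s y x] = s @: [set k : 'I_n | (k < (s^-1)%g x)%N].
  apply/setP => y; rewrite inE; apply/idP/imsetP.
    by move=> h; exists ((s^-1)%g y); rewrite ?inE ?permKV.
  by case=> k; rewrite inE => hk ->; rewrite /before permK.
rewrite card_imset; last exact: perm_inj.
have le : ((s^-1)%g x <= n)%N by apply: ltnW.
have inj : injective (widen_ord le) by move=> a b /(congr1 val) /= /val_inj.
rewrite -[RHS](card_ord ((s^-1)%g x)) -(card_imset predT inj).
apply: eq_card => k; rewrite inE; apply/idP/imsetP.
  by move=> h; exists (Ordinal h) => //; apply: val_inj.
by case=> l _ ->; rewrite /=.
Qed.

Lemma eq_before s t : (forall x y, before s x y = before t x y) -> s = t.
Proof.
move=> E; apply: (can_inj (@invgK _)); apply/permP => x; apply: val_inj.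
rewrite /= -!card_before; congr #|pred_of_set _|.
by apply/setP => y; rewrite !inE E.
Qed.

Lemma eq_inverted s t :
  (forall x y, x != y -> inverted s x y = inverted t x y) -> s = t.
Proof.
move=> E; apply: eq_before => x y; have [->|nxy] := eqVneq x y.
  by rewrite !before_irr.
by rewrite !before_inv E.
Qed.

Lemma perm_of_tournament (r : rel 'I_n) :
  (forall x, r x x = false) -> (forall x y, x != y -> r y x = ~~ r x y) ->
  transitive r -> exists s, forall x y, before s x y = r x y.
Proof.
move=> irr anti tr.
pose f x := #|[set y | r y x]|.
have fmono x y : r x y -> (f x < f y)%N.
  move=> rxy; apply: proper_card; apply/properP; split.
    by apply/fintype.subsetP => z; rewrite !inE => /tr; apply.
  by exists x; rewrite inE ?irr.
have fn x : (f x < n)%N.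
  rewrite -[X in (_ < X)%N]card_ord -cardsT; apply: proper_card; apply/properP; split.
    exact: finset.subsetT.
  by exists x; rewrite inE ?irr.
pose g x := Ordinal (fn x).
have ginj : injective g.
  move=> x y [] E; apply/eqP; apply: contraT => nxy.
  have := anti _ _ nxy; case: (boolP (r x y)) => [/fmono|_ /= /fmono]; rewrite E ltnn //.
exists ((perm ginj)^-1)%g => x y; rewrite /before invgK !permE /=.
apply/idP/idP => [h|]; last exact: fmono.
apply: contraTT h => nr; rewrite -leqNgt.
have [->//|nxy] := eqVneq x y.
by apply/ltnW/fmono; rewrite (anti _ _ nxy).
Qed.

(** Of the eight ways of inverting the three pairs of a triple, only the two
    excluded by the hypothesis are cyclic. *)
Lemma perm_of_inversions (K : rel 'I_n) :
  (forall x y, K x y = K y x) ->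
  (forall i j k, (i < j < k)%N ->
     ((K i j && K j k) ==> K i k) && (K i k ==> (K i j || K j k))) ->
  exists s, forall x y, x != y -> inverted s x y = K x y.
Proof.
move=> KC Ktr.
pose r x y := (x != y) && ((x < y)%N (+) K x y).
have [x|x y nxy|y x z|s sP] := @perm_of_tournament r.
- by rewrite /r eqxx.
- rewrite /r nxy eq_sym nxy /= (KC y x).
  by have := nxy; rewrite -val_eqE /=; case: ltngtP; case: (K x y).
- rewrite /r => /andP[nxy hxy] /andP[nyz hyz].
  have nxz : x != z.
    apply: contraTneq hyz => <-; move: hxy nxy; rewrite (KC y x) -val_eqE /=.
    by case: ltngtP; case: (K x y).
  rewrite nxz /=; move: hxy hyz.
  move: (Ktr x y z) (Ktr x z y) (Ktr y x z) (Ktr y z x) (Ktr z x y) (Ktr z y x).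
  rewrite ?(KC z y) ?(KC y x) ?(KC z x).
  move: nxy nyz nxz; rewrite -!val_eqE /=.
  case: (ltngtP x y) => // ? _; case: (ltngtP y z) => // ? _;
    case: (ltngtP x z) => // ? _; try lia;
    case: (K x y); case: (K y z); case: (K x z) => //=; lia.
exists s => x y nxy; rewrite /inverted sP /r nxy /=.
by case: (x < y)%N; case: (K x y).
Qed.

(** The peak-pit condition without the two extreme orders; a subset of a
    separated family is separated. *)
Definition separated (D : 'S_n -> Prop) : Prop :=
  forall i j k, (i < j < k)%N -> forall s t, D s -> D t ->
    before s j i -> before s j k -> before t i j -> before t k j -> False.

Lemma peak_pit_separated (D : {set 'S_n}) :
  peak_pit D <-> is_domain D /\ separated (fun s => s \in D).
Proof.
split=> -[Dd DP]; split=> //.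
  move=> i j k ijk s t Ds Dt h1 h2 h3 h4.
  have [/(_ s Ds)|/(_ t Dt)] := DP i j k ijk.
    by rewrite /peak_at h1 h2.
  by rewrite /pit_at h3 h4.
move=> i j k ijk; case: (pselect (forall s, s \in D -> peak_at s i j k)); first by left.
move=> nP; right=> t Dt; apply/negP => /andP[h3 h4].
apply: nP => s Ds; apply/negP => /andP[h1 h2].
exact: (DP i j k ijk s t).
Qed.

(** In a cyclic triple of orders each element is once least and once greatest,
    in particular the middle one. *)
Lemma separated_condorcet (D : {set 'S_n}) :
  is_domain D -> separated (fun s => s \in D) -> condorcet D.
Proof.
move=> Dd DP; split=> // -[i [j [k [[nij njk nik] [s [t [u [[Ds Dt Du] H]]]]]]]].
have sep x y z v w : (x < y < z)%N || (z < y < x)%N -> v \in D -> w \in D ->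
   before v y x && before v y z && (before w x y && before w z y) -> False.
  case/orP => lt Dv Dw /andP[/andP[h1 h2] /andP[h3 h4]].
    exact: (DP _ _ _ lt v w).
  exact: (DP _ _ _ lt v w).
move: nij njk nik; rewrite -!val_eqE /= => nij njk nik.
have [m|m|m] : [\/ (i < j < k) || (k < j < i), (j < i < k) || (k < i < j)
   | (i < k < j) || (j < k < i)]%N by apply/or3P; lia.
all: case: H => -[/andP[h1 h2] /andP[h3 h4] /andP[h5 h6]].
all: have h7 := before_trans h1 h2; have h8 := before_trans h3 h4; have h9 := before_trans h5 h6.
- by apply: (sep _ _ _ t u m) => //; rewrite h3 h8 h6 h9.
- by apply: (sep _ _ _ t u m) => //; rewrite h3 h8 h6 h9.
- by apply: (sep _ _ _ s t m) => //; rewrite h1 h7 h4 h8.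
- by apply: (sep _ _ _ u s m) => //; rewrite h5 h9 h2 h7.
- by apply: (sep _ _ _ u s m) => //; rewrite h5 h9 h2 h7.
- by apply: (sep _ _ _ s t m) => //; rewrite h1 h7 h4 h8.
Qed.

(** The two extreme orders have the middle element of every triple in the
    middle, so adding them breaks no condition. *)
Lemma separated_peak_pit_hull (D : {set 'S_n}) :
  separated (fun s => s \in D) ->
  exists D' : {set 'S_n}, [/\ D \subset D', condorcet D' & peak_pit D'].
Proof.
move=> DP; pose D' := alpha n |: (omega n |: D).
have dom : is_domain D' by split; rewrite !inE eqxx ?orbT.
have sep : separated (fun s => s \in D').
  move=> i j k /andP[ij jk] s t.
  have E s' : s' \in D' -> [\/ s' = 1%g, s' = omega n | s' \in D].
    by rewrite !inE => /or3P[/eqP|/eqP|]; [constructor 1|constructor 2|constructor 3].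
  move=> /E[->|->|Ds]; rewrite ?before1 ?before_omega; try by lia.
  move=> /E[->|->|Dt] h1 h2; rewrite ?before1 ?before_omega; try by lia.
  by apply: (DP i j k _ s t) => //; rewrite ij.
exists D'; split.
- by apply/fintype.subsetP => s Ds; rewrite !inE Ds !orbT.
- exact: separated_condorcet.
- by apply/peak_pit_separated.
Qed.

End Orders.

(** * Rankings of pairs *)

Section Rankings.
Variable n : nat.
Implicit Types (s t : 'S_n) (x y z i j k l a b u v w : 'I_n) (rk : 'I_n -> 'I_n -> nat).

Lemma inverted_triple s i j k : (i < j < k)%N ->
  ((inverted s i j && inverted s j k) ==> inverted s i k) &&
  (inverted s i k ==> (inverted s i j || inverted s j k)).
Proof.
move=> /andP[ij jk]; have ik := ltn_trans ij jk.
rewrite /inverted ij jk ik /=; apply/andP; split; apply/implyP.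
  case/andP; rewrite -!beforeN -?val_eqE ?ltn_eqF // => h1 h2; exact: before_trans h2 h1.
by rewrite -negb_and; apply: contra => /andP[]; apply: before_trans.
Qed.

Lemma pit_inverted s i j k : (i < j < k)%N ->
  pit_at s i j k = (inverted s j k ==> inverted s i j).
Proof.
move=> /andP[ij jk]; rewrite /pit_at /inverted ij jk /=.
rewrite (@beforeN _ s j k) -?val_eqE ?ltn_eqF //.
by case: (before s i j); case: (before s j k).
Qed.

Lemma peak_inverted s i j k : (i < j < k)%N ->
  peak_at s i j k = (inverted s i j ==> inverted s j k).
Proof.
move=> /andP[ij jk]; rewrite /peak_at /inverted ij jk /=.
rewrite (@beforeN _ s i j) -?val_eqE ?ltn_eqF //.
by case: (before s i j); case: (before s j k).
Qed.

(** Only the elements below m matter; the induction of the extension theorem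
    goes through m. *)
Definition admissible_on m rk : Prop :=
  (forall x y, rk x y = rk y x) /\
  (forall i j k, (i < j < k)%N -> (k < m)%N ->
     (rk i j < rk i k < rk j k)%N || (rk j k < rk i k < rk i j)%N).

Definition conforms_on m rk s : Prop :=
  forall i j k, (i < j < k)%N -> (k < m)%N ->
    if (rk i j < rk j k)%N then pit_at s i j k else peak_at s i j k.

Lemma distinct_cases x y z : x != y -> y != z -> x != z ->
  [\/ [\/ (x < y < z)%N, (x < z < y)%N | (y < x < z)%N] |
      [\/ (y < z < x)%N, (z < x < y)%N | (z < y < x)%N]].
Proof.
rewrite -!val_eqE /= => xy yz xz.
case: (ltngtP x y) xy => // hxy _; case: (ltngtP y z) yz => // hyz _;
  case: (ltngtP x z) xz => // hxz _; rewrite ?hxy ?hyz ?hxz /=; try lia;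
  try (by left; constructor); by right; constructor.
Qed.

(** This is the working form of the never conditions: pairs that share an
    element are inverted in the order of their ranks. *)
Lemma conforms_ideal m rk s x y z : admissible_on m rk -> conforms_on m rk s ->
  (x < m)%N -> (y < m)%N -> (z < m)%N -> x != y -> y != z -> x != z ->
  (rk x y < rk x z)%N -> inverted s x z -> inverted s x y.
Proof.
move=> [rkC rkP] cs xm ym zm xy yz xz.
have T i j k : (i < j < k)%N -> (k < m)%N ->
    (if (rk i j < rk j k)%N then inverted s j k ==> inverted s i j
    else inverted s i j ==> inverted s j k) /\
    (rk i j < rk i k < rk j k)%N || (rk j k < rk i k < rk i j)%N.
  move=> ijk km; move: (cs _ _ _ ijk km) (rkP _ _ _ ijk km).
  by rewrite pit_inverted // peak_inverted //; case: ifP.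
case: (distinct_cases xy yz xz) => -[] o.
all: have := inverted_triple s o; have [] // := T _ _ _ o.
all: rewrite ?(@invertedC _ s y x) ?(@invertedC _ s z x) ?(@invertedC _ s z y) 1?eq_sym //.
all: rewrite ?(rkC y x) ?(rkC z x) ?(rkC z y).
all: case: (inverted s x y); case: (inverted s x z); case: (inverted s y z); case: ifP => //=; lia.
Qed.

(** ** Adding an element to a ranking

    The new element m, the largest one, starts after all the others and moves
    to the front. It meets them in the order reached at that time, so it is
    inserted by choosing a set of pairs to be inverted before it moves, namely
    an initial part for the ranking. *)
Section Extension.
Variables (D : 'S_n -> Prop) (Dsep : separated D) (m : 'I_n) (rk : 'I_n -> 'I_n -> nat).
Hypotheses (rkP : admissible_on m rk) (Dconf : forall s, D s -> conforms_on m rk s).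

Let mx x y := if (x < y)%N then y else x.

(** On the triple formed with m, some order of D violates the pit condition,
    hence the peak condition must hold, and the pair has to be inverted after
    m has passed. For an early pair it is the opposite. *)
Definition late_pair x y := exists s,
  [/\ D s, ~~ inverted s x y & before s m (mx x y)].
Definition early_pair x y := exists s,
  [/\ D s, inverted s x y & before s (mx x y) m].

Let mxC x y : mx x y = mx y x.
Proof. by rewrite /mx; case: ltngtP => // /val_inj. Qed.

Let lateC x y : x != y -> late_pair x y -> late_pair y x.
Proof. by move=> xy [s [Ds h1 h2]]; exists s; rewrite mxC -invertedC. Qed.

Let earlyC x y : x != y -> early_pair x y -> early_pair y x.
Proof. by move=> xy [s [Ds h1 h2]]; exists s; rewrite mxC -invertedC. Qed.

Let late_lt x y : (x < y)%N -> late_pair x y ->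
  exists s, [/\ D s, before s x y & before s m y].
Proof.
by move=> xy [s [Ds h1 h2]]; exists s; move: h1 h2; rewrite /inverted /mx xy negbK.
Qed.

Let early_lt x y : (x < y)%N -> early_pair x y ->
  exists s, [/\ D s, before s y x & before s y m].
Proof.
move=> xy [s [Ds h1 h2]]; exists s; move: h1 h2; rewrite /inverted /mx xy /=.
by rewrite -beforeN // -val_eqE ltn_eqF.
Qed.

Let ltm_neq x : (x < m)%N -> x != m.
Proof. by move=> xm; rewrite -val_eqE ltn_eqF. Qed.

Lemma late_early x y : (x < m)%N -> (y < m)%N -> x != y ->
  late_pair x y -> early_pair x y -> False.
Proof.
have H i j : (i < j)%N -> (j < m)%N -> late_pair i j -> early_pair i j -> False.
  move=> ij jm /(late_lt ij)[t [Dt h3 h4]] /(early_lt ij)[s [Ds h1 h2]].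
  by apply: (Dsep (i := i) (j := j) (k := m) _ Ds Dt); rewrite // ij.
move=> xm ym xy hu hl; have [lt|lt|E] := ltngtP x y; first exact: (H x y).
  by apply: (H y x) => //; [exact: lateC | exact: earlyC].
by move: xy; rewrite (val_inj E) eqxx.
Qed.

(** Let s witness that xu is late. If xv is not late, then x and v precede m
    in s whereas u follows it, and the never conditions in s leave u as the
    largest of the three. The rank of vu is then below that of xv, so xv lies
    directly above the late pair vu, which again involves u. *)
Lemma late_pair_step x u v : (x < m)%N -> (u < m)%N -> (v < m)%N ->
  x != u -> u != v -> x != v -> late_pair x u -> (rk x u < rk x v)%N ->
  late_pair x v \/
  [/\ late_pair v u, (rk v u < rk x v)%N, (x < u)%N & (v < u)%N].
Proof.
have [rkC rkT] := rkP.
move=> xm um vm xu uv xv [s [Ds nxu mxu]] lt.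
have nxv : ~~ inverted s x v.
  by apply: contra nxu; apply: (conforms_ideal rkP (Dconf Ds)).
case: (boolP (before s m (mx x v))) => mxv; first by left; exists s.
right; have mxvm : mx x v != m by rewrite /mx; case: ifP => _; apply: ltm_neq.
have {mxv} bxvm : before s (mx x v) m by rewrite (@beforeN _ s m) 1?eq_sym.
have [bxm bvm] : before s x m /\ before s v m.
  move: nxv bxvm; rewrite /inverted /mx; case: ltngtP => [_|_|E].
  - by rewrite negbK => h1 h2; split=> //; apply: before_trans h2.
  - by rewrite /= -beforeN // => h1 h2; split=> //; apply: before_trans h2.
  - by move: xv; rewrite (val_inj E) eqxx.
have ltxu : (x < u)%N.
  move: mxu; rewrite /mx; case: ifP => // _ h.
  by have := before_trans bxm h; rewrite before_irr.
have bmu : before s m u by move: mxu; rewrite /mx ltxu.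
have bvu := before_trans bvm bmu.
have ltvu : (v < u)%N.
  case: ltngtP => // [ltuv|E]; last by move: uv; rewrite (val_inj E) eqxx.
  have ltxv := ltn_trans ltxu ltuv.
  have := @conforms_ideal m rk s v x u rkP (Dconf Ds) vm xm um.
  rewrite (eq_sym v x) (eq_sym v u) xv xu uv (rkC v x) (rkC v u) => /(_ erefl erefl erefl).
  have o : (x < u < v)%N by rewrite ltxu.
  have := rkT _ _ _ o vm => ch.
  rewrite -(invertedC s xv) (negbTE nxv) => H.
  apply: H; first by move: lt ch; clear; lia.
  by rewrite /inverted bvu ltnNge ltnW.
split=> //.
  exists s; split=> //; last by rewrite /mx ltvu.
  by rewrite /inverted ltvu bvu.
have [ltxv|ltvx|E] := ltngtP x v; last by move: xv; rewrite (val_inj E) eqxx.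
  have o : (x < v < u)%N by rewrite ltxv.
  by have := rkT _ _ _ o um; move: lt; clear; lia.
have o : (v < x < u)%N by rewrite ltvx.
by have := rkT _ _ _ o um; rewrite (rkC v x); move: lt; clear; lia.
Qed.

(** By the previous lemma the pairs at most one step above late pairs already
    form the upward closure of the late pairs. *)
Definition late_closure x u := late_pair x u \/
  exists w, [/\ (w < m)%N, (x < w)%N /\ (u < w)%N,
     late_pair x w, late_pair u w & (rk x w < rk x u)%N /\ (rk u w < rk x u)%N].

Lemma late_closureC x u : x != u -> late_closure x u -> late_closure u x.
Proof.
have [rkC rkT] := rkP.
move=> xu [h|[w [wm [xw uw] h1 h2 [h3 h4]]]]; first by left; apply: lateC.
by right; exists w; rewrite (rkC u x).
Qed.

Lemma late_closure_closed x u v : (x < m)%N -> (u < m)%N -> (v < m)%N ->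
  x != u -> u != v -> x != v -> late_closure x u -> (rk x u < rk x v)%N ->
  late_closure x v.
Proof.
have [rkC rkT] := rkP => xm um vm.
have base w : (w < m)%N -> x != w -> w != v -> x != v -> late_pair x w ->
    (rk x w < rk x v)%N -> late_closure x v.
  move=> wm xw wv xv h lt; case: (late_pair_step xm wm vm xw wv xv h lt); first by left.
  by move=> [h1 h2 h3 h4]; right; exists w.
move=> xu uv xv [h|[w [wm [xw uw] h1 h2 [h3 h4]]]] lt; first exact: (base u).
have [<-|wv] := eqVneq w v; first by left.
by apply: (base w) => //; [rewrite -val_eqE ltn_eqF | exact: ltn_trans lt].
Qed.

(** An order witnessing that xu is early inverts xw as well, hence puts w
    before x, u and m: then xw would be both late and early. *)
Lemma late_closure_early x u : (x < m)%N -> (u < m)%N -> x != u ->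
  late_closure x u -> early_pair x u -> False.
Proof.
have [rkC rkT] := rkP => xm um xu [|[w [wm [xw uw] h1 h2 [h3 h4]]]].
  exact: late_early.
have xw' : x != w by rewrite -val_eqE ltn_eqF.
have uw' : u != w by rewrite -val_eqE ltn_eqF.
move=> [s [Ds ixu bm]]; apply: (@late_early x w) => //; exists s.
have ixw : inverted s x w.
  by apply: (conforms_ideal rkP (Dconf Ds) (z := u)) => //; rewrite eq_sym.
have iuw : inverted s u w.
  apply: (conforms_ideal rkP (Dconf Ds) (z := x)) => //; try by rewrite eq_sym.
    by rewrite (rkC u x).
  by rewrite -invertedC.
split=> //; rewrite /mx xw.
move: ixw iuw; rewrite /inverted xw uw /= -!beforeN // => bwx bwu.
by move: bm; rewrite /mx; case: ifP => _; apply: before_trans.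
Qed.

Lemma extend_ranking : exists rk', admissible_on m.+1 rk' /\
  forall s, D s -> conforms_on m.+1 rk' s.
Proof.
have [rkC rkT] := rkP.
pose J x y := `[< late_closure x y >].
have JC x y : x != y -> J x y = J y x.
  by move=> xy; apply/asboolP/asboolP; apply: late_closureC; rewrite // eq_sym.
have Jup x u v : (x < m)%N -> (u < m)%N -> (v < m)%N ->
  x != u -> u != v -> x != v -> (rk x u < rk x v)%N -> J x u -> J x v.
  move=> *; apply/asboolP; apply: (@late_closure_closed x u v) => //; exact/asboolP.
have Jchain i j k : (i < j < k)%N -> (k < m)%N ->
   if (rk i j < rk j k)%N then (J i j ==> J i k) && (J i k ==> J j k)
   else (J j k ==> J i k) && (J i k ==> J i j).
  move=> /[dup] o /andP[ij jk] km; have ik := ltn_trans ij jk.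
  have jm := ltn_trans jk km; have im := ltn_trans ij jm.
  have [nij njk nik] : [/\ i != j, j != k & i != k] by rewrite -!val_eqE !ltn_eqF.
  have nji : j != i by rewrite eq_sym.
  have nkj : k != j by rewrite eq_sym.
  have nki : k != i by rewrite eq_sym.
  have := rkT _ _ _ o km; case: ifP => lt ch; apply/andP; split; apply/implyP.
  - by apply: Jup => //; lia.
  - by rewrite (JC i k) // (JC j k) //; apply: Jup => //; rewrite !(rkC k); lia.
  - by rewrite (JC i k) // (JC j k) //; apply: Jup => //; rewrite !(rkC k); lia.
  - by apply: Jup => //; lia.
have [x y|i j k|sg sgP] := @perm_of_inversions n
    (fun x y => [&& (x < m)%N, (y < m)%N, x != y & ~~ J x y]).
- by have [->//|xy] := eqVneq x y; rewrite (JC x y) // andbCA.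
- move=> /[dup] o /andP[ij jk]; have ik := ltn_trans ij jk.
  have [nij njk nik] : [/\ i != j, j != k & i != k] by rewrite -!val_eqE !ltn_eqF.
  case: (ltnP k m) => km; last by rewrite !andbF /=.
  have jm := ltn_trans jk km; have im := ltn_trans ij jm.
  rewrite im jm nij njk nik /=; have := Jchain _ _ _ o km.
  by case: (J i j); case: (J j k); case: (J i k); case: ifP.
(* The ranks are below M; the pairs (i, m) get ranks in the window from M to
   M + n, in the order in which m meets the elements, and the late pairs
   are shifted above this window. *)
have [M MP] : exists M, forall x y, (rk x y < M)%N.
  exists (\max_(p : 'I_n * 'I_n) rk p.1 p.2).+1 => x y.
  by rewrite ltnS (@leq_bigmax _ (fun p : 'I_n * 'I_n => rk p.1 p.2) (x, y)).
pose low i j := if J i j then (M + n + rk i j).+1 else rk i j.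
pose mid i := (M + n - (sg^-1)%g i)%N.
pose rk' i j := if (i < m)%N && (j < m)%N then (if i == j then 0%N else low i j)
  else if (i < m)%N then mid i else if (j < m)%N then mid j else 0%N.
have lowE i j : (i < j)%N -> (j < m)%N -> rk' i j = low i j.
  by move=> ij jm; rewrite /rk' jm (ltn_trans ij jm) /= -val_eqE ltn_eqF.
have midE i : (i < m)%N -> rk' i m = mid i.
  by move=> im; rewrite /rk' im ltnn.
exists rk'; split; first split.
- move=> x y; rewrite /rk' andbC (eq_sym y x); case: eqP => [->//|/eqP xy].
  rewrite /low (JC y x) 1?eq_sym // (rkC y x).
  by case: (ltnP x m); case: (ltnP y m).
- move=> i j k /[dup] o /andP[ij jk]; rewrite ltnS leq_eqVlt => /orP[/eqP/val_inj Ek|km].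
    subst k; rewrite lowE // !midE //; last exact: ltn_trans jk.
    have im := ltn_trans ij jk.
    have nij : i != j by rewrite -val_eqE ltn_eqF.
    have := sgP i j nij; rewrite im jk nij /= /inverted ij /= => /negb_inj.
    have := ltn_ord ((sg^-1)%g i); have := ltn_ord ((sg^-1)%g j).
    rewrite /low /mid; have := MP i j; case: (J i j) => h h1 h2.
      by rewrite /before; lia.
    by move=> /negbT; rewrite -beforeN // /before; lia.
  have jm := ltn_trans jk km.
  rewrite !lowE //; last exact: ltn_trans jk.
  have := rkT _ _ _ o km; have := Jchain _ _ _ o km; rewrite /low.
  move: (MP i j) (MP i k) (MP j k).
  by case: (J i j); case: (J j k); case: (J i k); case: ifP => //=; lia.
move=> s Ds i j k /[dup] o /andP[ij jk]; rewrite ltnS leq_eqVlt => /orP[/eqP/val_inj Ek|km].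
  subst k; rewrite lowE // !midE //.
  have im := ltn_trans ij jk.
  have nij : i != j by rewrite -val_eqE ltn_eqF.
  have := ltn_ord ((sg^-1)%g i); have := ltn_ord ((sg^-1)%g j).
  rewrite /low /mid; have := MP i j; case: (boolP (J i j)) => Jij h h1 h2.
    case: ifP => [|_]; first by lia.
    apply/negP => /andP[b1 b2]; apply: (late_closure_early im jk nij (asboolW Jij)).
    by exists s; split=> //; rewrite ?/inverted ?/mx ij //= -beforeN.
  case: ifP => [_|]; last by lia.
  apply: contra Jij => /andP[b1 b2]; apply/asboolP; left.
  by exists s; split=> //; rewrite ?/inverted ?/mx ij //= negbK.
have jm := ltn_trans jk km.
have := Dconf Ds o km; rewrite !lowE // /low.
have := rkT _ _ _ o km; have := Jchain _ _ _ o km.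
move: (MP i j) (MP i k) (MP j k).
case: (J i j); case: (J j k); case: (J i k); case: ifP => //= h1 h2 h3 h4 _ ch;
  case: ifP => //; lia.
Qed.

End Extension.

(** Injectivity on pairs lets the pairs be inverted one at a time. *)
Definition admissible rk : Prop :=
  [/\ forall x y, rk x y = rk y x,
      forall i j k, (i < j < k)%N ->
        (rk i j < rk i k < rk j k)%N || (rk j k < rk i k < rk i j)%N
    & forall i j k l, (i < j)%N -> (k < l)%N -> rk i j = rk k l -> i = k /\ j = l].

Definition conforms rk s : Prop := forall i j k, (i < j < k)%N ->
  if (rk i j < rk j k)%N then pit_at s i j k else peak_at s i j k.

(** Ties of the ranking obtained by induction are broken by a code of the pair;
    pairs of one triple have no ties. *)
Theorem separated_ranking (D : 'S_n -> Prop) : separated D ->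
  exists rk, admissible rk /\ forall s, D s -> conforms rk s.
Proof.
move=> Dsep.
have [rk [[rkC rkT] rkD]] : exists rk, admissible_on n rk /\ forall s, D s -> conforms_on n rk s.
  have H m : (m <= n)%N -> exists rk, admissible_on m rk /\ forall s, D s -> conforms_on m rk s.
    elim: m => [_|m IH mn]; first by exists (fun _ _ => 0%N).
    have [rk [h1 h2]] := IH (ltnW mn).
    exact: (@extend_ranking D Dsep (Ordinal mn) rk h1 h2).
  exact: H.
(* The code of a pair is its sorted value in base n, which is below n * n. *)
pose code x y := (minn x y * n + maxn x y)%N.
have codelt x y : (code x y < n * n)%N.
  have [hx hy] := (ltn_ord x, ltn_ord y).
  have [a [b [ha hb E]]] : exists a b : nat, [/\ (a < n)%N, (b < n)%N & code x y = (a * n + b)%N].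
    by exists (minn x y), (maxn x y); rewrite /code; split=> //; lia.
  rewrite E; nia.
pose rk' x y := (rk x y * (n * n) + code x y)%N.
have lt' x y z w : (rk x y < rk z w)%N -> (rk' x y < rk' z w)%N.
  by move=> lt; rewrite /rk'; have := codelt x y; nia.
exists rk'; split; first split.
- by move=> x y; rewrite /rk' /code rkC minnC maxnC.
- move=> i j k o; have := rkT _ _ _ o (ltn_ord k).
  by case/orP => /andP[/lt' h1 /lt' h2]; rewrite h1 h2 ?orbT.
- move=> i j k l ij kl E.
  have : code i j = code k l.
    by have := congr1 (modn^~ (n * n)%N) E; rewrite /rk' !modnMDl !modn_small.
  have n0 : (0 < n)%N by apply: leq_ltn_trans (ltn_ord i).
  have codeE x y : (x < y)%N -> code x y = (x * n + y)%N.
    by move=> /ltnW xy; rewrite /code (minn_idPl xy) (maxn_idPr xy).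
  rewrite !codeE // => E2.
  have := congr1 (divn^~ n) E2; rewrite !divnMDl // !divn_small // !addn0 => ?.
  have := congr1 (modn^~ n) E2; rewrite !modnMDl !modn_small // => ?.
  by split; apply: val_inj.
move=> s Ds i j k o; have := rkD s Ds _ _ _ o (ltn_ord k).
have := rkT _ _ _ o (ltn_ord k).
by case/orP => /andP[h1 h2]; have lt := ltn_trans h1 h2; have := lt' _ _ _ _ lt;
  do 2 case: ifP => //; move: lt; clear; lia.
Qed.

End Rankings.

(** * Flips of adjacent elements *)

Section Flips.
Variable n : nat.
Implicit Types (s t u : 'S_n) (x y z i j a b : 'I_n) (rk : 'I_n -> 'I_n -> nat).
Implicit Types (k l : 'I_n.-1) (w : seq 'I_n.-1).

Definition same_pair x y a b := ((x == a) && (y == b)) || ((x == b) && (y == a)).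

(** One step up in the Bruhat order, described by the pair that becomes
    inverted. *)
Definition flips s a b t : Prop :=
  [/\ (a < b)%N, before s a b &
   forall x y, x != y -> inverted t x y = inverted s x y || same_pair x y a b].

Lemma flips_before s a b t x y : flips s a b t -> ~~ same_pair x y a b ->
  before t x y = before s x y.
Proof.
move=> [_ _ E] nsp; have [->|xy] := eqVneq x y; first by rewrite !before_irr.
by rewrite !before_inv E // (negbTE nsp) orbF.
Qed.

Lemma flips_swapped s a b t : flips s a b t -> before t b a.
Proof.
move=> [ab _ E]; have nba : b != a by rewrite -val_eqE gtn_eqF.
by rewrite before_inv E // /same_pair !eqxx orbT orbT addbT -leqNgt ltnW.
Qed.

(** An element between a and b in s would stay so in t, where b precedes a. *)
Lemma flips_adjacent s a b t x : flips s a b t -> x != a -> x != b ->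
  before s x b = before s x a.
Proof.
move=> fl xa xb; have [ab sab E] := fl.
apply/idP/idP => [h|h]; last exact: before_trans sab.
apply: contraT; rewrite -beforeN // => h'.
have h1 : before t a x.
  by rewrite (flips_before fl) // /same_pair (negbTE xa) (negbTE xb) !andbF.
have h2 : before t x b.
  by rewrite (flips_before fl) // /same_pair (negbTE xa) (negbTE xb).
have := before_trans (before_trans h1 h2) (flips_swapped fl).
by rewrite before_irr.
Qed.

Definition pos0 k : 'I_n := widen_ord (leq_pred n) k.
Definition pos1 k : 'I_n := ordS (pos0 k).

Lemma pos1E k : pos1 k = k.+1 :> nat.
Proof. by rewrite /= modn_small //; have := ltn_ord k; lia. Qed.

Lemma std_transpE k : std_transp k = tperm (pos0 k) (pos1 k).
Proof. by []. Qed.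

Lemma std_transp_lt k (p q : 'I_n) : p != q ->
  (std_transp k p < std_transp k q)%N = (p < q)%N (+) same_pair p q (pos0 k) (pos1 k).
Proof.
move=> pq; rewrite std_transpE /same_pair -!val_eqE.
have := pos1E k; have : pos0 k = k :> nat by [].
move: pq; rewrite -val_eqE; move: (pos0 k) (pos1 k) => i i' pq ik i'k.
by case: tpermP => [->|->|/eqP + /eqP]; case: tpermP => [->|->|/eqP + /eqP];
  move: pq; rewrite -?val_eqE /=; rewrite ?ik ?i'k; clear; lia.
Qed.

Lemma std_before k s x y : x != y -> before (std_transp k * s)%g x y =
  before s x y (+) same_pair x y (s (pos0 k)) (s (pos1 k)).
Proof.
move=> xy; have tV : ((std_transp k)^-1)%g = std_transp k by rewrite std_transpE tpermV.
rewrite /before invMg tV !permM std_transp_lt ?(inj_eq perm_inj) //.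
by rewrite /same_pair !(canF_eq (permKV s)).
Qed.

Lemma std_flips k s : (s (pos0 k) < s (pos1 k))%N ->
  flips s (s (pos0 k)) (s (pos1 k)) (std_transp k * s)%g.
Proof.
move=> lt; split=> // [|x y xy].
  by rewrite /before !permK pos1E /=.
rewrite /inverted std_before // addbA -/(inverted s x y).
case: (boolP (same_pair x y _ _)) => [sp|]; last by rewrite addbF orbF.
rewrite addbT orbT /inverted; move: sp; rewrite /same_pair.
case/orP => /andP[/eqP-> /eqP->].
  by rewrite lt /before !permK pos1E /= ltnSn.
by rewrite ltnNge ltnW //= /before !permK pos1E /= ltnNge ltnW.
Qed.

Lemma flips_std s a b t : flips s a b t ->
  exists k, [/\ t = (std_transp k * s)%g, a = s (pos0 k) & b = s (pos1 k)].
Proof.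
move=> fl; have [ab sab E] := fl.
have posb : (s^-1)%g b = ((s^-1)%g a).+1 :> nat.
  rewrite -!card_before.
  have -> : [set y | before s y b] = a |: [set y | before s y a].
    apply/setP => x; rewrite !inE; have [->|xa] := eqVneq x a; first by rewrite sab.
    have [->|xb] := eqVneq x b; last exact: flips_adjacent fl xa xb.
    by rewrite before_irr /= beforeN ?sab // -val_eqE ltn_eqF.
  by rewrite cardsU1 inE before_irr.
have kn : ((s^-1)%g a < n.-1)%N by have := ltn_ord ((s^-1)%g b); lia.
pose k := Ordinal kn.
have p0 : pos0 k = (s^-1)%g a by apply: val_inj.
have p1 : pos1 k = (s^-1)%g b by apply: val_inj; apply: etrans (pos1E k) (esym posb).
have Ea : a = s (pos0 k) by rewrite p0 permKV.
have Eb : b = s (pos1 k) by rewrite p1 permKV.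
exists k; split=> //; apply: eq_inverted => x y xy; rewrite E //.
have lt : (s (pos0 k) < s (pos1 k))%N by rewrite -Ea -Eb.
by have [_ _ ->] := std_flips lt; rewrite // -Ea -Eb.
Qed.

Lemma flips_Inv s a b t : flips s a b t -> Inv t = (a, b) |: Inv s /\ (a, b) \notin Inv s.
Proof.
move=> [ab sab E]; split; last by rewrite mem_Inv ab /inverted ab sab.
apply/setP => -[x y]; rewrite !inE -!/(before _ _ _) /=.
have := mem_Inv t x y; have := mem_Inv s x y; rewrite !inE /= => -> ->.
case: ltnP => [xy|yx] /=.
  rewrite E -?val_eqE ?ltn_eqF // /same_pair xpair_eqE orbC.
  case: (boolP ((x == b) && _)) => [/andP[/eqP xb /eqP ya]|]; last by rewrite orbF.
  by move: xy; rewrite xb ya ltnNge ltnW.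
by rewrite xpair_eqE; case: eqP => //= xa; case: eqP => //= yb; move: yx; rewrite xa yb leqNgt ab.
Qed.

Lemma card_Inv_std k s : (#|Inv (std_transp k * s)%g| <= #|Inv s|.+1)%N.
Proof.
set a := s (pos0 k); set b := s (pos1 k).
pose p := if (a < b)%N then (a, b) else (b, a).
apply: (@leq_trans #|p |: Inv s|); last by rewrite cardsU1; case: (_ \notin _).
apply/subset_leq_card/fintype.subsetP => -[x y].
rewrite in_setU1 !mem_Inv => /andP[xy]; rewrite xy /inverted std_before -?val_eqE ?ltn_eqF //.
rewrite addbA; case: (boolP (same_pair x y a b)) => [sp _|_]; last by rewrite addbF => ->; rewrite orbT.
apply/orP; left; move: sp; rewrite /same_pair /p => /orP[] /andP[/eqP Ex /eqP Ey].
  by rewrite -Ex -Ey xy.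
by rewrite -Ex -Ey ltnNge ltnW //= Ex Ey.
Qed.

Lemma card_Inv1 : #|Inv (1%g : 'S_n)| = 0.
Proof. by apply: eq_card0 => -[x y]; rewrite mem_Inv inverted1 andbF. Qed.

Lemma weak_le_inverted s t : (forall x y, x != y -> inverted s x y -> inverted t x y) -> weak_le s t.
Proof.
move=> h; apply/fintype.subsetP => -[x y]; rewrite !mem_Inv => /andP[xy i].
by rewrite xy h // -val_eqE ltn_eqF.
Qed.

Lemma Inv_inj s t : Inv s = Inv t -> s = t.
Proof.
move=> E; apply: eq_inverted => x y xy.
have H a b : (a < b)%N -> inverted s a b = inverted t a b.
  by move=> ab; have := mem_Inv s a b; rewrite E mem_Inv ab.
have [lt|lt|E'] := ltngtP x y; last by move: xy; rewrite (val_inj E') eqxx.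
  exact: H.
by rewrite !(invertedC _ xy); apply: H.
Qed.

Lemma bruhat_adj_sym s t : bruhat_adj s t = bruhat_adj t s.
Proof. by rewrite /bruhat_adj orbC. Qed.

Lemma flips_bruhat_adj s a b t : flips s a b t -> bruhat_adj s t.
Proof.
move=> fl; have [E nI] := flips_Inv fl; apply/orP; left; apply/andP; split.
  by rewrite /weak_le E subsetU1.
rewrite E; apply/cards1P; exists (a, b); apply/setP => p.
by rewrite finset.in_setD in_setU1 finset.in_set1; case: eqVneq => [->|] //=; [rewrite nI | rewrite andNb].
Qed.

Lemma pos_far (c d : 'I_n.-1) : (c.+1 < d)%N || (d.+1 < c)%N ->
  [/\ pos0 c != pos0 d, pos0 c != pos1 d, pos1 c != pos0 d & pos1 c != pos1 d].
Proof.
move=> far; split; apply/eqP => /(congr1 (@nat_of_ord n)); rewrite ?pos1E => /= E;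
  move: far E; clear; lia.
Qed.

Lemma std_transp_comm (c d : 'I_n.-1) : (c.+1 < d)%N || (d.+1 < c)%N ->
  commute (std_transp c) (std_transp d).
Proof.
move=> /pos_far[h1 h2 h3 h4]; apply/permP => x.
rewrite !permM !std_transpE.
case: (tpermP (pos0 c) (pos1 c) x) => [->|->|/eqP xc0 /eqP xc1].
- by rewrite !(tpermD (x := pos0 d)) ?tpermL // eq_sym.
- by rewrite !(tpermD (x := pos0 d)) ?tpermR // eq_sym.
case: (tpermP (pos0 d) (pos1 d) x) => [_|_|/eqP xd0 /eqP xd1].
- by rewrite tpermD.
- by rewrite tpermD.
by rewrite tpermD // eq_sym.
Qed.

Definition word_equiv := clos_refl_trans _ (@commutation_move n.-1).

Lemma word_equiv_cons c w w' : word_equiv w w' -> word_equiv (c :: w) (c :: w').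
Proof.
elim=> [{}w {}w' [u [v [i [j [far -> ->]]]]]|?|? ? ? _ h1 _ h2].
- by apply: rt_step; exists (c :: u), v, i, j.
- exact: rt_refl.
- exact: rt_trans h1 h2.
Qed.

End Flips.

(** * Climbing inside the orders conforming to a ranking *)

Section Climbs.
Variables (n : nat) (rk : 'I_n -> 'I_n -> nat).
Hypothesis rkP : admissible rk.
Implicit Types (s t u : 'S_n) (x y z i j k l a b : 'I_n).
Implicit Types (w : seq 'I_n.-1).

Let rkC x y : rk x y = rk y x. Proof. by case: rkP. Qed.
Let rkT i j k : (i < j < k)%N ->
  (rk i j < rk i k < rk j k)%N || (rk j k < rk i k < rk i j)%N.
Proof. by case: rkP => _ + _; apply. Qed.
Lemma conforms_closed s x y z : conforms rk s -> x != y -> y != z -> x != z ->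
  (rk x y < rk x z)%N -> inverted s x z -> inverted s x y.
Proof.
move=> cs; apply: (@conforms_ideal n n rk s x y z) => //.
  by split=> [|i j k o _]; [exact: rkC | exact: rkT].
by move=> i j k o _; apply: cs.
Qed.

Lemma closed_conforms s :
  (forall x y z, x != y -> y != z -> x != z -> (rk x y < rk x z)%N ->
     inverted s x z -> inverted s x y) -> conforms rk s.
Proof.
move=> cl i j k /[dup] o /andP[ij jk]; have ik := ltn_trans ij jk.
have [nij njk nik] : [/\ i != j, j != k & i != k] by rewrite -!val_eqE !ltn_eqF.
have nji : j != i by rewrite eq_sym.
have := rkT o; case: ifP => lt ch.
  rewrite pit_inverted // (invertedC s nij); apply/implyP; apply: cl => //.
  by rewrite rkC.
rewrite peak_inverted // (invertedC s nij); apply/implyP; apply: cl => //; first by rewrite eq_sym.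
by rewrite (rkC j i); move: ch lt; clear; lia.
Qed.

Lemma perm_of_closed (K : rel 'I_n) : (forall x y, K x y = K y x) ->
  (forall x y z, x != y -> y != z -> x != z -> (rk x y < rk x z)%N -> K x z -> K x y) ->
  exists s, conforms rk s /\ forall x y, x != y -> inverted s x y = K x y.
Proof.
move=> KC cl; have [i j k /[dup] o /andP[ij jk]|s sP] := perm_of_inversions KC.
  have ik := ltn_trans ij jk.
  have [nij njk nik] : [/\ i != j, j != k & i != k] by rewrite -!val_eqE !ltn_eqF.
  have [nji nkj nki] : [/\ j != i, k != j & k != i] by rewrite -!val_eqE !gtn_eqF.
  apply/andP; split; apply/implyP.
    case/andP => Kij Kjk; case/orP: (rkT o) => /andP[h1 h2].
      by rewrite KC; apply: (cl k i j) => //; rewrite 1?KC // !(rkC k).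
    by apply: (cl i k j).
  move=> Kik; apply/orP; case/orP: (rkT o) => /andP[h1 h2].
    by left; apply: (cl i j k).
  by right; rewrite KC; apply: (cl k j i) => //; rewrite 1?KC // !(rkC k).
exists s; split=> //; apply: closed_conforms => x y z xy yz xz.
by rewrite !sP //; apply: cl.
Qed.

Lemma conforms_separated : separated (conforms rk).
Proof.
move=> i j k ijk s t cs ct h1 h2 h3 h4.
have := cs i j k ijk; have := ct i j k ijk; case: ifP => _.
  by rewrite /pit_at h3 h4.
by rewrite /peak_at h1 h2.
Qed.

(** The word w leads from s to t by steps that add an inversion and never
    leave the conforming orders. *)
Fixpoint climbs s w t : Prop :=
  if w is k :: w' then
    [/\ (s (pos0 k) < s (pos1 k))%N, conforms rk (std_transp k * s)%g
      & climbs (std_transp k * s)%g w' t]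
  else s = t.

Lemma climbs_cat s w1 w2 t : climbs s (w1 ++ w2) t <->
  exists u, climbs s w1 u /\ climbs u w2 t.
Proof.
elim: w1 s => [|k w1 IH] s /=; first by split=> [|[u [->]]//]; exists s.
split=> [[h1 h2 /IH[u [h3 h4]]]|[u [[h1 h2 h3] h4]]]; first by exists u.
by split=> //; apply/IH; exists u.
Qed.

Lemma climbs_conforms s w t : conforms rk s -> climbs s w t -> conforms rk t.
Proof. by elim: w s => [|k w IH] s cs /= => [<-|[_ h]]; last apply: IH. Qed.

Lemma climbs_card s w t : climbs s w t -> #|Inv t| = (#|Inv s| + size w)%N.
Proof.
elim: w s => [|k w IH] s /= => [->|[/std_flips/flips_Inv[E nI] _ /IH->]]; first by rewrite addn0.
by rewrite E cardsU1 nI add1n addSnnS.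
Qed.

Lemma climbs_inverted s w t x y : climbs s w t -> x != y -> inverted s x y -> inverted t x y.
Proof.
move=> + xy; elim: w s => [|k w IH] s /= => [->//|[/std_flips[_ _ E] _ /IH h] sxy].
by apply: h; rewrite E // sxy.
Qed.

Lemma climbs_foldl s w t : climbs s w t -> foldl (fun s c => (std_transp c * s)%g) s w = t.
Proof. by elim: w s => [|k w IH] s /= => [|[_ _ /IH]]. Qed.

(** Among the pairs inverted in t and not in s take the one of least rank:
    adding it to the inversions of s keeps the order conforming. *)
Lemma climb_exists s t : conforms rk s -> conforms rk t ->
  (forall x y, x != y -> inverted s x y -> inverted t x y) -> exists w, climbs s w t.
Proof.
have [m] := ubnP (#|Inv t| - #|Inv s|); elim: m s => // m IH s lem cs ct le.
pose P (p : 'I_n * 'I_n) := [&& (p.1 < p.2)%N, inverted t p.1 p.2 & ~~ inverted s p.1 p.2].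
case: (pickP P) => [p0 Pp0|P0]; last first.
  exists [::]; apply: eq_inverted => x y xy; apply/idP/idP; first exact: le.
  have [lt|lt|E] := ltngtP x y; last by move: xy; rewrite (val_inj E) eqxx.
    by move=> h; have := P0 (x, y); rewrite /P /= lt h => /negbFE.
  by rewrite !(invertedC _ xy) => h; have := P0 (y, x); rewrite /P /= lt h => /negbFE.
case: (arg_minnP (fun p => rk p.1 p.2) Pp0) => -[a b] /and3P[/= ab tab sab] mn.
have nab : a != b by rewrite -val_eqE ltn_eqF.
have spC x y : same_pair x y a b = same_pair y x a b.
  by rewrite /same_pair; case: (x == a); case: (x == b); case: (y == a); case: (y == b).
have [||u [cu uP]] := @perm_of_closed (fun x y => [&& x != y & inverted s x y || same_pair x y a b]).
- by move=> x y; rewrite eq_sym spC; case: eqVneq => //= yx; rewrite (invertedC s yx).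
- move=> x y z xy yz xz lt; rewrite xy xz /= => /orP[h|h].
    by rewrite (conforms_closed cs xy yz xz lt h).
  have [txz rxz] : inverted t x z /\ rk x z = rk a b.
    case/orP: h => /andP[/eqP-> /eqP->] //.
    by rewrite -(invertedC t nab) rkC.
  apply/orP; left; apply: contraT => nsxy.
  have txy := conforms_closed ct xy yz xz lt txz.
  have [l|l|E] := ltngtP x y; last by move: xy; rewrite (val_inj E) eqxx.
    by have := mn (x, y); rewrite /P /= l txy nsxy => /(_ erefl); rewrite leqNgt -rxz lt.
  have := mn (y, x); rewrite /P /= l -!(invertedC _ xy) txy nsxy => /(_ erefl).
  by rewrite leqNgt -rxz (rkC y x) lt.
have fl : flips s a b u.
  split=> //; last by move=> x y xy; rewrite uP // xy.
  by move: sab; rewrite /inverted ab negbK.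
have [k [Eu Ea Eb]] := flips_std fl.
have leu x y : x != y -> inverted u x y -> inverted t x y.
  move=> xy; rewrite uP // xy => /orP[|/orP[]/andP[/eqP-> /eqP->]] //; first exact: le.
  by rewrite -(invertedC t nab).
have [EI nI] := flips_Inv fl.
have leI : (#|Inv u| <= #|Inv t|)%N.
  apply/subset_leq_card/fintype.subsetP => -[x y]; rewrite !mem_Inv => /andP[xy h].
  by rewrite xy leu // -val_eqE ltn_eqF.
have [|w hw] := IH u _ cu ct leu.
  by move: lem leI; rewrite EI cardsU1 nI; lia.
by exists (k :: w) => /=; rewrite -Eu -Ea -Eb.
Qed.

(** Two different first steps on overlapping positions would invert ij only
    and jk only, for the same triple i < j < k. *)
Lemma climb_diamond s (c d : 'I_n.-1) : conforms rk s -> c != d ->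
  (s (pos0 c) < s (pos1 c))%N -> conforms rk (std_transp c * s)%g ->
  (s (pos0 d) < s (pos1 d))%N -> conforms rk (std_transp d * s)%g ->
  (c.+1 < d)%N || (d.+1 < c)%N.
Proof.
have H (e f : 'I_n.-1) : f = e.+1 :> nat ->
    (s (pos0 e) < s (pos1 e))%N -> conforms rk (std_transp e * s)%g ->
    (s (pos0 f) < s (pos1 f))%N -> conforms rk (std_transp f * s)%g -> False.
  move=> fe lte ce ltf cf.
  have pe : pos1 e = pos0 f by apply: val_inj; apply: etrans (pos1E e) _; rewrite /= fe.
  have [_ _ Ee] := std_flips lte; have [_ _ Ef] := std_flips ltf.
  have bfe := flips_before (std_flips lte); have bff := flips_before (std_flips ltf).
  rewrite -pe in ltf Ef bff; set x := s (pos0 e) in lte Ee bfe ltf Ef bff.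
  set y := s (pos1 e) in lte Ee bfe ltf Ef bff; set z := s (pos1 f) in ltf Ef bff.
  have o : (x < y < z)%N by rewrite lte.
  have [xy yz xz] : [/\ x != y, y != z & x != z].
    by rewrite -!val_eqE !ltn_eqF // (ltn_trans lte ltf).
  have [yx zy zx] : [/\ y != x, z != y & z != x] by rewrite !(eq_sym y) !(eq_sym z).
  have nxy : inverted s x y = false.
    by rewrite /inverted lte /before !permK pos1E /= ltnSn.
  have nyz : inverted s y z = false.
    by rewrite /inverted ltf /before !permK /z !pos1E fe ltnSn.
  have := ce _ _ _ o; have := cf _ _ _ o.
  rewrite !pit_inverted // !peak_inverted // !Ee // !Ef // nxy nyz /same_pair !eqxx.
  by rewrite (negbTE yx) (negbTE zx) (negbTE xy) (negbTE xz) (negbTE yz) (negbTE zy); case: ifP.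
move=> cs ncd lc cc ld cd; have [lt|lt|E] := ltngtP c d; last by move: ncd; rewrite (val_inj E) eqxx.
  move: lt; rewrite leq_eqVlt => /orP[/eqP E|->//].
  by case: (H c d).
move: lt; rewrite leq_eqVlt => /orP[/eqP E|->]; last by rewrite orbT.
by case: (H d c).
Qed.

(** If the words start with different letters, these commute, the order v
    reached by both conforms, and the two words are compared through a word
    passing by v. *)
Lemma climb_unique s w w' t : conforms rk s -> climbs s w t -> climbs s w' t ->
  word_equiv w w'.
Proof.
have [m] := ubnP (size w); elim: m s w w' => // m IH s [|c w] [|d w'].
- by move=> _ _ _ _; apply: rt_refl.
- by move=> _ _ E /climbs_card; rewrite -(E : s = t) /= => h; exfalso; lia.
- by move=> _ _ + E => /climbs_card; rewrite -(E : s = t) /= => h; exfalso; lia.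
rewrite [X in (X < _)%N]/= ltnS => szw cs cl1 cl2.
have [lc cc hw] := cl1; have [ld cd hw'] := cl2.
have [Ecd|ncd] := eqVneq c d.
  by subst d; apply: word_equiv_cons; apply: IH hw hw'.
have far := climb_diamond cs ncd lc cc ld cd.
have ct := climbs_conforms cc hw.
have fixed (e f : 'I_n.-1) : (e.+1 < f)%N || (f.+1 < e)%N ->
    (std_transp e * s)%g (pos0 f) = s (pos0 f) /\ (std_transp e * s)%g (pos1 f) = s (pos1 f).
  by move=> /pos_far[h1 h2 h3 h4]; rewrite !permM std_transpE !tpermD.
have far' : (d.+1 < c)%N || (c.+1 < d)%N by rewrite orbC.
have [c0 c1] := fixed c d far; have [d0 d1] := fixed d c far'.
pose v := (std_transp d * (std_transp c * s))%g.
have vE : v = (std_transp c * (std_transp d * s))%g by rewrite /v !mulgA (std_transp_comm far).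
have ld' : ((std_transp c * s)%g (pos0 d) < (std_transp c * s)%g (pos1 d))%N by rewrite c0 c1.
have lc' : ((std_transp d * s)%g (pos0 c) < (std_transp d * s)%g (pos1 c))%N by rewrite d0 d1.
have [_ _ Ev] := std_flips ld'; have [_ _ Ec] := std_flips lc; have [_ _ Ed] := std_flips ld.
have vI x y : x != y -> inverted v x y = inverted (std_transp c * s)%g x y || inverted (std_transp d * s)%g x y.
  by move=> xy; rewrite Ev // c0 c1 Ed // Ec // -!orbA; case: (inverted s x y) => //=; rewrite ?orbT // orbC.
have cv : conforms rk v.
  apply: closed_conforms => x y z xy yz xz lt; rewrite !vI // => /orP[]h.
    by rewrite (conforms_closed cc xy yz xz lt h).
  by rewrite (conforms_closed cd xy yz xz lt h) orbT.
have [|w0 hw0] := climb_exists cv ct.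
  by move=> x y xy; rewrite vI // => /orP[]; [apply: climbs_inverted hw _ | apply: climbs_inverted hw' _].
have sz0 : (size (c :: w0) < m)%N.
  have := climbs_card hw; have := climbs_card hw0; have [Iv nI] := flips_Inv (std_flips ld').
  by rewrite {1}/v Iv cardsU1 nI /=; move: szw; clear; lia.
apply: (@rt_trans _ _ _ (c :: d :: w0)).
  by apply: word_equiv_cons; apply: IH szw cc hw _; split=> //; rewrite -/v.
apply: (@rt_trans _ _ _ (d :: c :: w0)).
  by apply: rt_step; exists [::], w0, c, d.
apply: word_equiv_cons; apply: IH sz0 cd _ hw'.
by split=> //; rewrite -vE.
Qed.

Lemma conforms1 : conforms rk 1%g.
Proof. by apply: closed_conforms => x y z xy _ xz _; rewrite inverted1. Qed.

Lemma conforms_omega : conforms rk (omega n).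
Proof. by apply: closed_conforms => x y z xy _ _ _ _; apply: inverted_omega. Qed.

Section MaximalClimb.
Variable w : seq 'I_n.-1.
Hypothesis wP : climbs 1%g w (omega n).

Lemma climb_prefix m : climbs 1%g (take m w) (word_perm (take m w)) /\
   climbs (word_perm (take m w)) (drop m w) (omega n).
Proof.
have := wP; rewrite -{1}(cat_take_drop m w) => /climbs_cat[u [h1 h2]].
by rewrite /word_perm (climbs_foldl h1).
Qed.

Lemma card_Inv_prefix m : (m <= size w)%N -> #|Inv (word_perm (take m w))| = m.
Proof.
by move=> le; have [/climbs_card -> _] := climb_prefix m; rewrite card_Inv1 size_takel.
Qed.

Lemma prefix_weak_le m m' : (m <= m')%N -> weak_le (word_perm (take m w)) (word_perm (take m' w)).
Proof.
move=> le; apply: weak_le_inverted => x y xy.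
have [_] := climb_prefix m; rewrite -(cat_take_drop (m' - m) (drop m w)).
move=> /climbs_cat[u [h1 h2]]; apply: climbs_inverted xy.
suff -> : word_perm (take m' w) = u by exact: h1.
rewrite -(climbs_foldl h1) /word_perm -foldl_cat.
by rewrite -takeD subnKC.
Qed.

(** A comparable order with as many inversions as a prefix equals it. *)
Lemma climb_maximal_chain : maximal_chain (chain_of_word w).
Proof.
apply/maxsetP; split.
  apply/forallP => s; apply/implyP => /imsetP[m _ ->]; apply/forallP => t; apply/implyP => /imsetP[m' _ ->].
  by case/orP: (leq_total m m') => le; apply/orP; [left|right]; exact: prefix_weak_le.
move=> B /forallP Bch /fintype.subsetP sub; apply/eqP; rewrite finset.eqEsubset; apply/andP; split; last exact/fintype.subsetP.
apply/fintype.subsetP => s sB.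
have szw : #|Inv (omega n)| = size w by rewrite (climbs_card wP) card_Inv1.
have le : (#|Inv s| <= size w)%N.
  rewrite -szw; apply: subset_leq_card; apply: weak_le_inverted => x y xy _.
  exact: inverted_omega.
pose m : 'I_(size w).+1 := Ordinal (le : (#|Inv s| < (size w).+1)%N).
have cC : word_perm (take m w) \in chain_of_word w by apply/imsetP; exists m.
suff -> : s = word_perm (take m w) by [].
have cI : #|Inv (word_perm (take m w))| = #|Inv s| by rewrite card_Inv_prefix.
have /implyP/(_ sB)/forallP/(_ (word_perm (take m w)))/implyP/(_ (sub _ cC)) := Bch s.
case/orP => h; apply: Inv_inj; apply/eqP; [|rewrite eq_sym];
  by rewrite eqEcard cI leqnn andbT.
Qed.

Lemma climb_reduced : reduced_decomposition w.
Proof.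
split; first exact: climbs_foldl wP.
have H w' s : (#|Inv (foldl (fun s c => (std_transp c * s)%g) s w')| <= #|Inv s| + size w')%N.
  elim: w' s => [|c w' IH] s /=; first by rewrite addn0.
  by apply: leq_trans (IH _) _; rewrite addnS -addSn leq_add2r card_Inv_std.
move=> w' E; have := H w' 1%g; rewrite -/(word_perm w') E card_Inv1 (climbs_card wP) card_Inv1.
by [].
Qed.

End MaximalClimb.

(** A climb from the identity to the reversed order may be chosen through any
    conforming order, and all these climbs are equivalent. *)
Theorem conforms_GR_domain : exists D : {set 'S_n},
  GR_domain D /\ forall s, conforms rk s -> s \in D.
Proof.
have le1 t x y : x != y -> inverted 1%g x y -> inverted t x y by rewrite inverted1.
have leo s x y : x != y -> inverted s x y -> inverted (omega n) x y.
  by move=> xy _; apply: inverted_omega.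
have [w wP] := climb_exists conforms1 conforms_omega (@le1 _).
pose C0 := chain_of_word w.
pose Q s := exists C : {set 'S_n}, [/\ maximal_chain C, chain_equiv C0 C & s \in C].
exists [set s | `[< Q s >]]; split.
  exists C0; split; first exact: climb_maximal_chain.
  by move=> s; rewrite inE; split=> /asboolP.
move=> s cs; rewrite inE; apply/asboolP.
have [w1 h1] := climb_exists conforms1 cs (@le1 _).
have [w2 h2] := climb_exists cs conforms_omega (@leo _).
have h12 : climbs 1%g (w1 ++ w2) (omega n) by apply/climbs_cat; exists s.
exists (chain_of_word (w1 ++ w2)); split; first exact: climb_maximal_chain.
  exists w, (w1 ++ w2); split=> //; try exact: climb_reduced.
  exact: climb_unique conforms1 wP h12.
have lt : (size w1 < (size (w1 ++ w2)).+1)%N by rewrite size_cat ltnS leq_addr.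
apply/imsetP; exists (Ordinal lt) => //=.
by rewrite take_size_cat // /word_perm (climbs_foldl h1).
Qed.

Theorem conforms_connected (D : {set 'S_n}) :
  (forall s, s \in D <-> conforms rk s) -> connected_domain D.
Proof.
move=> DP; pose e := [rel x y | [&& x \in D, y \in D & @bruhat_adj n x y]].
have esym : connect_sym e.
  by apply: sym_connect_sym => x y /=; rewrite bruhat_adj_sym andbCA.
have up s w t : s \in D -> climbs s w t -> connect e s t.
  elim: w s => [|c w IH] s sD /=; first by move=> ->; apply: connect0.
  case=> lt cs cl; have sD' : (std_transp c * s)%g \in D by apply/DP.
  apply: connect_trans (IH _ sD' cl); apply: connect1.
  by rewrite /= sD sD' (flips_bruhat_adj (std_flips lt)).
have from1 s : s \in D -> connect e 1%g s.
  move=> /DP cs; have [|w] := climb_exists conforms1 cs; first by move=> x y _; rewrite inverted1.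
  by apply: up; apply/DP; apply: conforms1.
by move=> s t sD tD; apply: connect_trans (from1 t tD); rewrite esym; apply: from1.
Qed.


End Climbs.

(** * GR-domains, connected domains and the Fishburn domain *)

Section GRDomains.
Variable n : nat.
Implicit Types (s t u v : 'S_n) (x y z i j k : 'I_n) (c d : 'I_n.-1) (w : seq 'I_n.-1).

Lemma mem_chain_of_word s w :
  (s \in chain_of_word w) <-> exists m, s = word_perm (take m w).
Proof.
split=> [/imsetP[m _ ->]|[m ->]]; first by exists m.
case: (leqP m (size w)) => le.
  by apply/imsetP; exists (Ordinal (le : (m < (size w).+1)%N)).
apply/imsetP; exists (Ordinal (ltnSn (size w))) => //=.
by rewrite take_size take_oversize // ltnW.
Qed.

Lemma word_perm_cat w w' :
  word_perm (w ++ w') = foldl (fun s c => (std_transp c * s)%g) (word_perm w) w'.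
Proof. by rewrite /word_perm foldl_cat. Qed.

(** Two commuting steps exchange four different elements, so at most one of
    them exchanges two elements of a given triple. *)
Lemma commuting_steps_triple c d s i j k : (c.+1 < d)%N || (d.+1 < c)%N ->
  let T := [:: i; j; k] in
  (forall x y, x \in T -> y \in T -> before (std_transp d * s)%g x y = before s x y) \/
  (forall x y, x \in T -> y \in T ->
     before (std_transp d * s)%g x y = before (std_transp c * (std_transp d * s))%g x y).
Proof.
move=> far T; have [h1 h2 h3 h4] := pos_far far.
pose a := s (pos0 d); pose b := s (pos1 d); pose a' := s (pos0 c); pose b' := s (pos1 c).
have Ea : (std_transp d * s)%g (pos0 c) = a'.
  by rewrite permM std_transpE tpermD // eq_sym.
have Eb : (std_transp d * s)%g (pos1 c) = b'.
  by rewrite permM std_transpE tpermD // eq_sym.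
have H (e : 'I_n.-1) (r : 'S_n) : ~~ ((r (pos0 e) \in T) && (r (pos1 e) \in T)) ->
    forall x y, x \in T -> y \in T -> before (std_transp e * r)%g x y = before r x y.
  move=> nT x y xT yT; have [->|xy] := eqVneq x y; first by rewrite !before_irr.
  rewrite std_before //; case: (boolP (same_pair _ _ _ _)) => [|_]; last by rewrite addbF.
  by case/orP => /andP[/eqP E1 /eqP E2]; move: nT; rewrite -E1 -E2 xT yT.
case: (boolP ((a \in T) && (b \in T))) => [/andP[aT bT]|]; last by left; apply: H.
right=> x y xT yT; rewrite (H c) // Ea Eb; apply/negP => /andP[a'T b'T].
have neq (e : 'I_n.-1) : pos0 e != pos1 e.
  by apply/eqP => /(congr1 (@nat_of_ord n)); rewrite pos1E /=; clear; lia.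
have uq : uniq [:: a'; b'; a; b].
  by rewrite /= !inE !(inj_eq perm_inj) !negb_or h1 h2 h3 h4 !neq.
have sub : {subset [:: a'; b'; a; b] <= T}.
  by move=> z; rewrite !in_cons in_nil orbF => /or4P[] /eqP->.
by have := uniq_leq_size uq sub.
Qed.

(** A commutation move replaces one order of the chain, and on a triple the
    new order agrees with one of its two neighbours in the old chain. *)
Lemma commutation_move_triple (Q : 'S_n -> Prop) i j k w w' :
  (forall s t, (forall x y, x \in [:: i; j; k] -> y \in [:: i; j; k] ->
     before s x y = before t x y) -> Q t -> Q s) ->
  commutation_move w w' ->
  (forall s, s \in chain_of_word w -> Q s) -> (forall s, s \in chain_of_word w' -> Q s).
Proof.
move=> Qext [u [v [c [d [far -> ->]]]]] Qw s /mem_chain_of_word[m ->].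
have Qw' m' : Q (word_perm (take m' (u ++ [:: c; d] ++ v))).
  by apply: Qw; apply/mem_chain_of_word; exists m'.
have [le|lt] := leqP m (size u).
  by have := Qw' m; rewrite !takel_cat.
have E w0 : take m (u ++ w0) = u ++ take (m - size u) w0.
  by rewrite take_cat ltnNge ltnW.
have := Qw' m; rewrite !E; case Em: (m - size u)%N => [|[|r]].
- by move: Em lt; lia.
- move=> Quc; have Qu := Qw' (size u); have Qucd := Qw' (size u).+2.
  have take2 : take (size u).+2 (u ++ [:: c; d] ++ v) = u ++ [:: c; d].
    by rewrite catA take_size_cat // size_cat /= addn2.
  rewrite take_size_cat // in Qu; rewrite take2 word_perm_cat /= in Qucd.
  rewrite word_perm_cat /=.
  have [H|H] := commuting_steps_triple (word_perm u) i j k far; first exact: Qext Qu.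
  by apply: Qext Qucd => x y xT yT; rewrite H // !mulgA (std_transp_comm far).
by rewrite !word_perm_cat /= !mulgA (std_transp_comm far).
Qed.

(** Orders of a chain have nested inversion sets: once the middle element of
    a triple is least, the pair ij is inverted and the middle element is not
    greatest later; once it is greatest, jk is inverted and it is not least
    later. *)
Theorem GR_domain_separated (D : {set 'S_n}) : GR_domain D -> separated (fun s => s \in D).
Proof.
move=> [C0 [C0max DP]] i j k ijk s t sD tD.
have [C0chain _] := maxsetP C0max.
have transport (Q : 'S_n -> Prop) r :
  (forall s t, (forall x y, x \in [:: i; j; k] -> y \in [:: i; j; k] ->
     before s x y = before t x y) -> Q t -> Q s) ->
  (forall s, s \in C0 -> Q s) -> r \in D -> Q r.
  move=> Qext QC0 /DP[C [_ [w [w' [_ _ EC0 EC ww']]] rC]].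
  rewrite {}EC in rC; rewrite {}EC0 in QC0.
  elim: ww' r QC0 rC => [w1 w2 h|w1|w1 w2 w3 _ IH1 _ IH2] r QC0.
  - exact: (commutation_move_triple Qext h QC0).
  - exact: QC0.
  - by apply: IH2 => r'; apply: IH1.
have memT : [/\ i \in [:: i; j; k], j \in [:: i; j; k] & k \in [:: i; j; k]].
  by rewrite !inE !eqxx !orbT.
case: memT => iT jT kT.
have [ij jk] := andP ijk.
have [nij njk] : i != j /\ j != k by rewrite -!val_eqE !ltn_eqF.
case: (pselect (forall s, s \in C0 -> peak_at s i j k)) => [peak|npeak].
  have : peak_at s i j k by apply: (transport (fun r => peak_at r i j k)) => // r r' E; rewrite /peak_at !E.
  by rewrite /peak_at => pk h1 h2; rewrite h1 h2 in pk.
have pit r : r \in C0 -> pit_at r i j k.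
  move=> rC0; apply/negP => /andP[h3 h4]; apply: npeak => q qC0; apply/negP => /andP[h1 h2].
  have /forallP/(_ q)/implyP/(_ qC0)/forallP/(_ r)/implyP/(_ rC0) := C0chain.
  case/orP => /fintype.subsetP le.
    have := le (i, j); rewrite !mem_Inv ij /inverted ij h3 /= => /(_ _); rewrite -beforeN //.
    by move=> /(_ h1).
  have := le (j, k); rewrite !mem_Inv jk /inverted jk h2 /= => /(_ _); rewrite -beforeN //.
  by move=> /(_ h4).
have : pit_at t i j k by apply: (transport (fun r => pit_at r i j k)) => // r r' E; rewrite /pit_at !E.
by rewrite /pit_at => pt _ _ h3 h4; rewrite h3 h4 in pt.
Qed.

Lemma connect_crossing (T : finType) (e : rel T) (P : pred T) (x y : T) :
  connect e x y -> P x -> ~~ P y -> exists u v : T, [/\ e u v, P u & ~~ P v].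
Proof.
case/connectP => p + ->; elim: p x => [|z p IH] x /=; first by move=> _ ->.
case/andP => xz pth Px nPy; case: (boolP (P z)) => Pz; first exact: (IH z).
by exists x, z.
Qed.

(** On a path from the identity to its reverse there is a step exchanging the
    outer elements i and k of the triple: ikj becomes kij, or jik becomes jki.
    With ijk and kji, which are present, the Condorcet condition then
    excludes both restrictions of the other side. *)
Theorem connected_condorcet_separated (D : {set 'S_n}) :
  condorcet D -> connected_domain D -> separated (fun s => s \in D).
Proof.
move=> [[aD oD] nC] Dconn i j k /andP[ij jk] s t sD tD sji sjk tij tkj.
have ik := ltn_trans ij jk.
have [nij njk nik] : [/\ i != j, j != k & i != k] by rewrite -!val_eqE !ltn_eqF.
have nkj : k != j by rewrite eq_sym.
have cyc1 (a b c : 'S_n) : a \in D -> b \in D -> c \in D ->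
    restricts a i j k -> restricts b j k i -> restricts c k i j -> False.
  move=> *; apply: nC; exists i, j, k; split=> //; exists a, b, c; split=> //; by left.
have cyc2 (a b c : 'S_n) : a \in D -> b \in D -> c \in D ->
    restricts a k j i -> restricts b j i k -> restricts c i k j -> False.
  move=> *; apply: nC; exists i, j, k; split=> //; exists a, b, c; split=> //; by right.
have ra : restricts (alpha n) i j k by rewrite /restricts !before1 ij.
have ro : restricts (omega n) k j i by rewrite /restricts !before_omega ij jk.
have [||u [v [/and3P[uD vD adj] uik vik]]] :=
  connect_crossing (P := fun r => before r i k) (Dconn _ _ aD oD).
- by rewrite before1.
- by rewrite before_omega -leqNgt ltnW.
rewrite -beforeN // in vik.
have ikv : (i, k) \in Inv v by rewrite mem_Inv ik /inverted ik /= -beforeN.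
have iku : (i, k) \notin Inv u by rewrite mem_Inv ik /inverted ik uik.
have /andP[le /cards1P[p Ep]] : covers v u.
  case/orP: adj => // /andP[/fintype.subsetP/(_ _ ikv)]; by rewrite (negbTE iku).
have pE : p = (i, k).
  by apply/eqP; rewrite eq_sym -finset.in_set1 -Ep finset.in_setD iku ikv.
have same x y : (x < y)%N -> (x, y) != (i, k) -> before u x y = before v x y.
  move=> xy ne; have nexy : x != y by rewrite -val_eqE ltn_eqF.
  have : ((x, y) \in Inv v :\: Inv u) = false by rewrite Ep finset.in_set1 pE (negbTE ne).
  rewrite finset.in_setD => /negbT; rewrite negb_and negbK => h.
  have : ((x, y) \in Inv u) = ((x, y) \in Inv v).
    by apply/idP/idP => [|xyv]; [exact: (fintype.subsetP le) | move: h; rewrite xyv orbF].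
  by rewrite !mem_Inv xy /inverted xy /= => /negb_inj.
have sij : before u i j = before v i j by apply: same; rewrite // xpair_eqE eqxx /= njk.
have sjk' : before u j k = before v j k by apply: same; rewrite // xpair_eqE eq_sym (negbTE nij).
case: (boolP (before u i j)) => uij.
  have vij : before v i j by rewrite -sij.
  have vkj := before_trans vik vij.
  have ukj : before u k j by rewrite beforeN // sjk' -beforeN.
  case: (boolP (before s k i)) => [ski|].
    by apply: (cyc1 (alpha n) s v); rewrite // /restricts ?sjk ?vik.
  rewrite beforeN // negbK => sik.
  by apply: (cyc2 (omega n) s u); rewrite // /restricts ?sji ?uik.
rewrite -beforeN // in uij.
have ujk := before_trans uij uik.
have vjk : before v j k by rewrite -sjk'.
case: (boolP (before t i k)) => [tik|].
  by apply: (cyc2 (omega n) u t); rewrite // /restricts ?uij ?tik.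
rewrite -beforeN // => tki.
by apply: (cyc1 (alpha n) v t); rewrite // /restricts ?vjk ?tki.
Qed.

Definition fishburn : {set 'S_n} :=
  [set s : 'S_n | [forall i : 'I_n, forall j : 'I_n, forall k : 'I_n,
       (i < j < k)%N ==>
       if odd j.+1 then pit_at s i j k else peak_at s i j k]].

Lemma fishburn_separated : separated (fun s => s \in fishburn).
Proof.
have H s i j k : s \in fishburn -> (i < j < k)%N ->
    if odd j.+1 then pit_at s i j k else peak_at s i j k.
  rewrite inE => /forallP/(_ i)/forallP/(_ j)/forallP/(_ k)/implyP; exact.
move=> i j k ijk s t sD tD h1 h2 h3 h4.
have := H _ _ _ _ sD ijk; have := H _ _ _ _ tD ijk; case: ifP => _.
  by rewrite /pit_at h3 h4.
by rewrite /peak_at h1 h2.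
Qed.

End GRDomains.

Import Order.TTheory GRing.Theory Num.Theory.

(** * Tiles in the plane *)

Section Plane.
Variable R : realType.
Local Open Scope ring_scope.
Implicit Types (p q u v w : 'rV[R]_2).

Lemma rv2P u v : u 0 0 = v 0 0 -> u 0 1 = v 0 1 -> u = v.
Proof.
move=> h0 h1; apply/rowP => k; case: k => [[|[|//]] lt].
  by have -> : Ordinal lt = 0 by apply: val_inj.
by have -> : Ordinal lt = 1 by apply: val_inj.
Qed.

Definition det2 u v := u 0 0 * v 0 1 - u 0 1 * v 0 0.

(** The vector (t, 0), kept opaque so that computing coordinates does not
    unfold it. *)
Lemma horizontal_ex : {h : R -> 'rV[R]_2 | forall t, h t 0 0 = t /\ h t 0 1 = 0}.
Proof.
exists (fun t => \row_(k < 2) if (k : nat) is 0%N then t else 0) => t.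
by rewrite !mxE.
Qed.
Definition horizontal := sval horizontal_ex.

Lemma horizontalX t : horizontal t 0 0 = t.
Proof. by rewrite /horizontal; case: horizontal_ex => h /= /(_ t)[]. Qed.
Lemma horizontalY t : horizontal t 0 1 = 0.
Proof. by rewrite /horizontal; case: horizontal_ex => h /= /(_ t)[]. Qed.

(** For all small positive numbers. *)
Definition near0 (P : R -> Prop) : Prop :=
  exists2 e, 0 < e & forall t, 0 < t -> t <= e -> P t.

Lemma near0_and P Q : near0 P -> near0 Q -> near0 (fun t => P t /\ Q t).
Proof.
move=> [e e0 eP] [f f0 fQ]; exists (Num.min e f); first by rewrite lt_min e0.
by move=> t t0; rewrite le_min => /andP[te tf]; split; [apply: eP | apply: fQ].
Qed.

Lemma near0_ex P : near0 P -> exists2 t, 0 < t & P t.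
Proof. by case=> e e0 eP; exists e => //; apply: eP. Qed.

Lemma near0_impl (P Q : R -> Prop) : (forall t, 0 < t -> P t -> Q t) -> near0 P -> near0 Q.
Proof. by move=> PQ [e e0 eP]; exists e => // t t0 te; apply: PQ => //; apply: eP. Qed.

(** A tile is given by such weak inequalities, whence its closedness. *)
Lemma near0_le x k : near0 (fun t => x <= t * k -> x <= 0).
Proof.
have [x0|x0] := lerP x 0; first by exists 1.
have k1 : 0 < `|k| + 1 by rewrite ltr_wpDl.
exists (x / (2 * (`|k| + 1))); first by rewrite divr_gt0 // mulr_gt0.
move=> t t0; rewrite ler_pdivlMr ?mulr_gt0 // => tx xk; exfalso.
have := ler_norm k; nra.
Qed.

Lemma near0_all (A : eqType) (r : seq A) (P : A -> R -> Prop) :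
  (forall a, a \in r -> near0 (P a)) -> near0 (fun t => forall a, a \in r -> P a t).
Proof.
elim: r => [|a r IH] H; first by exists 1.
have [|e e0 eP] := near0_and (H a (mem_head _ _)) (IH _).
  by move=> b br; apply: H; rewrite in_cons br orbT.
exists e => // t t0 te b; have [h1 h2] := eP t t0 te.
by rewrite in_cons => /orP[/eqP->|]; last exact: h2.
Qed.

End Plane.

Section Zonogon.
Variables (R : realType) (n : nat) (xi : 'I_n -> 'rV[R]_2).
Hypothesis xiP : zonogon_vectors xi.
Local Open Scope ring_scope.
Implicit Types (p q u v w : 'rV[R]_2) (i j k a b c d x y : 'I_n) (s : 'S_n).

Lemma xiY_gt0 i : 0 < xi i 0 1.
Proof. by case: xiP. Qed.

Lemma det_xi i j : (i < j)%N -> det2 (xi i) (xi j) < 0.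
Proof. by case: xiP => _ _; apply. Qed.

Lemma xi_independent i j (a b a' b' : R) : (i < j)%N ->
  a *: xi i + b *: xi j = a' *: xi i + b' *: xi j -> a = a' /\ b = b'.
Proof.
move=> ij E; have D := det_xi ij.
have E0 := congr1 (fun v : 'rV[R]_2 => v 0 0) E; have E1 := congr1 (fun v : 'rV[R]_2 => v 0 1) E.
rewrite !mxE in E0 E1; rewrite /det2 in D.
have H (z : R) : z * (xi i 0 0 * xi j 0 1 - xi i 0 1 * xi j 0 0) = 0 -> z = 0.
  by move/eqP; rewrite mulf_eq0 (lt_eqF D) orbF => /eqP.
split; apply/eqP; rewrite -subr_eq0; apply/eqP/H.
  transitivity ((a * xi i 0 0 + b * xi j 0 0 - (a' * xi i 0 0 + b' * xi j 0 0)) * xi j 0 1 -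
    (a * xi i 0 1 + b * xi j 0 1 - (a' * xi i 0 1 + b' * xi j 0 1)) * xi j 0 0); first by ring.
  by rewrite E0 E1; ring.
transitivity ((a * xi i 0 1 + b * xi j 0 1 - (a' * xi i 0 1 + b' * xi j 0 1)) * xi i 0 0 -
    (a * xi i 0 0 + b * xi j 0 0 - (a' * xi i 0 0 + b' * xi j 0 0)) * xi i 0 1); first by ring.
by rewrite E0 E1; ring.
Qed.

Lemma xi_span i j v : (i < j)%N -> exists a b : R, v = a *: xi i + b *: xi j.
Proof.
move=> ij; have D := det_xi ij.
exists (det2 v (xi j) / det2 (xi i) (xi j)), (det2 (xi i) v / det2 (xi i) (xi j)).
move: D; rewrite /det2 => D; apply: rv2P; rewrite !mxE; field; exact: ltr0_neq0.
Qed.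

(** Moving to the right decreases the coordinate on the left vector and
    increases the one on the right vector. *)
Lemma horizontal_xi i j : (i < j)%N -> exists k l : R, [/\ 0 < k, 0 < l &
  forall t, horizontal t = - (t * k) *: xi i + (t * l) *: xi j].
Proof.
move=> ij; have D := det_xi ij.
have D' : 0 < - det2 (xi i) (xi j) by rewrite oppr_gt0.
exists (xi j 0 1 / - det2 (xi i) (xi j)), (xi i 0 1 / - det2 (xi i) (xi j)).
split; try by rewrite divr_gt0 // xiY_gt0.
move=> t; apply: rv2P; rewrite !mxE ?horizontalX ?horizontalY; move: D; rewrite /det2 => D;
  field; exact: ltr0_neq0.
Qed.

Lemma tile_left_vertex p i j : (i < j)%N ->
  near0 (fun t => tile_set xi (p, i, j) (p + xi i + horizontal t)).
Proof.
move=> ij; have [k [l [k0 l0 H]]] := horizontal_xi ij.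
exists (Num.min k^-1 l^-1); first by rewrite lt_min !invr_gt0 k0.
move=> t t0; rewrite le_min => /andP[tk tl].
have tk1 : t * k <= 1 by rewrite -ler_pdivlMr // mul1r.
have tl1 : t * l <= 1 by rewrite -ler_pdivlMr // mul1r.
have tk0 : 0 < t * k by rewrite mulr_gt0.
have tl0 : 0 < t * l by rewrite mulr_gt0.
exists (1 - t * k), (t * l); split; [lra|lra|].
by rewrite H; apply: rv2P; rewrite !mxE; ring.
Qed.

Lemma tile_right_edge p i j e : (i < j)%N -> e = (p, j) \/ e = (p + xi j, i) ->
  near0 (fun t => tile_set xi (p, i, j) (e.1 + (1 / 2) *: xi e.2) /\
     tile_set xi (p, i, j) (e.1 + (1 / 2) *: xi e.2 - horizontal t)).
Proof.
move=> ij ed; have [k [l [k0 l0 H]]] := horizontal_xi ij.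
exists (Num.min (k^-1 / 2) (l^-1 / 2)); first by rewrite lt_min !divr_gt0 ?invr_gt0.
move=> t t0; rewrite le_min => /andP[tk tl].
have tk1 : t * k <= 1 / 2 by rewrite -ler_pdivlMr // mul1r mulrC.
have tl1 : t * l <= 1 / 2 by rewrite -ler_pdivlMr // mul1r mulrC.
have tk0 : 0 < t * k by rewrite mulr_gt0.
have tl0 : 0 < t * l by rewrite mulr_gt0.
case: ed => -> /=; split.
- by exists 0, (1 / 2); split; [lra|lra|]; apply: rv2P; rewrite !mxE; ring.
- exists (t * k), (1 / 2 - t * l); split; [lra|lra|].
  by rewrite H; apply: rv2P; rewrite !mxE; ring.
- by exists (1 / 2), 1; split; [lra|lra|]; apply: rv2P; rewrite !mxE; ring.
- exists (1 / 2 + t * k), (1 - t * l); split; [lra|lra|].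
  by rewrite H; apply: rv2P; rewrite !mxE; ring.
Qed.

Lemma tile_closed_right p i j q : (i < j)%N ->
  near0 (fun t => tile_set xi (p, i, j) (q + horizontal t) -> tile_set xi (p, i, j) q).
Proof.
move=> ij; have [k [l [k0 l0 H]]] := horizontal_xi ij.
have [A [B E]] := xi_span (q - p) ij.
apply: near0_impl (near0_and (near0_le (A - 1) k) (near0_le (- B) l)) => t t0 [hA hB].
move=> [a [b [/andP[a0 a1] /andP[b0 b1] Eq]]].
have [Ea Eb] : A = a + t * k /\ B = b - t * l.
  apply: (xi_independent ij); rewrite -E.
  have -> : q = p + a *: xi i + b *: xi j - horizontal t by rewrite -Eq addrK.
  by rewrite H; apply: rv2P; rewrite !mxE; ring.
have tk0 : 0 < t * k by rewrite mulr_gt0.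
have tl0 : 0 < t * l by rewrite mulr_gt0.
exists A, B; split.
- by apply/andP; split; [lra|]; have := hA; lra.
- by apply/andP; split; [|lra]; have := hB; lra.
by rewrite -addrA -E addrC subrK.
Qed.

Lemma tile_edge_mid t e : e \in tile_edges xi t -> tile_set xi t (e.1 + (1 / 2) *: xi e.2).
Proof.
case: t => [[p i] j]; rewrite !inE => /or4P[] /eqP -> /=.
- by exists (1 / 2), 0; split; [lra|lra|]; apply: rv2P; rewrite !mxE; ring.
- by exists 0, (1 / 2); split; [lra|lra|]; apply: rv2P; rewrite !mxE; ring.
- by exists 1, (1 / 2); split; [lra|lra|]; apply: rv2P; rewrite !mxE; ring.
- by exists (1 / 2), 1; split; [lra|lra|]; apply: rv2P; rewrite !mxE; ring.
Qed.

Lemma tile_coords p i j (a b a' b' : R) q : (i < j)%N ->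
  q = p + a *: xi i + b *: xi j -> q = p + a' *: xi i + b' *: xi j -> a = a' /\ b = b'.
Proof. by move=> ij -> E; apply: (xi_independent ij); apply: (addrI p); rewrite !addrA. Qed.

Lemma tile_edge_coords p i j e (t : R) : e \in tile_edges xi (p, i, j) ->
  exists a b : R, e.1 + t *: xi e.2 = p + a *: xi i + b *: xi j /\
   [\/ [/\ e = (p, i), a = t & b = 0], [/\ e = (p, j), a = 0 & b = t],
       [/\ e = (p + xi i, j), a = 1 & b = t] | [/\ e = (p + xi j, i), a = t & b = 1]].
Proof.
rewrite !inE => /or4P[] /eqP -> /=.
- by exists t, 0; split; [apply: rv2P; rewrite !mxE; ring | constructor 1].
- by exists 0, t; split; [apply: rv2P; rewrite !mxE; ring | constructor 2].
- by exists 1, t; split; [apply: rv2P; rewrite !mxE; ring | constructor 3].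
- by exists t, 1; split; [apply: rv2P; rewrite !mxE; ring | constructor 4].
Qed.

Lemma tile_edge_mid_unique p i j e e' : (i < j)%N ->
  e \in tile_edges xi (p, i, j) -> e' \in tile_edges xi (p, i, j) ->
  edge_set xi e' (e.1 + (1 / 2) *: xi e.2) -> e = e'.
Proof.
move=> ij /(tile_edge_coords (1 / 2))[a [b [E H]]] he' [t [_ Et]].
have [a' [b' [E' H']]] := tile_edge_coords t he'.
have [Ea Eb] : a = a' /\ b = b' by apply: (tile_coords ij E); rewrite Et E'.
clear E E' Et; case: H => -[-> Ha Hb]; case: H' => -[-> Ha' Hb'] //; exfalso; lra.
Qed.

Lemma tile_edge_mid_vertex p i j e : (i < j)%N -> e \in tile_edges xi (p, i, j) ->
  e.1 + (1 / 2) *: xi e.2 \notin tile_vertices xi (p, i, j).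
Proof.
move=> ij /(tile_edge_coords (1 / 2))[a [b [E H]]]; apply/negP.
have V (a' b' : R) q : (a', b') \in [:: (0, 0); (1, 0); (0, 1); (1, 1)] ->
   q = p + a' *: xi i + b' *: xi j -> e.1 + (1 / 2) *: xi e.2 <> q.
  move=> h Eq Ee; have [Ea Eb] : a = a' /\ b = b' by apply: (tile_coords ij E); rewrite Ee.
  clear E Eq Ee; move: h; rewrite !inE => /or4P[] /eqP[Ha' Hb']; case: H => -[_ Ha Hb]; lra.
rewrite !inE => /or4P[] /eqP; [apply: (V 0 0)|apply: (V 1 0)|apply: (V 0 1)|apply: (V 1 1)];
  by rewrite ?inE ?eqxx ?orbT //; apply: rv2P; rewrite !mxE; ring.
Qed.

(** The two edges listed are the left ones; from the middle of a right edge
    a step to the right leaves the tile. *)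
Lemma tile_edge_left p i j e (t : R) : (i < j)%N -> e \in tile_edges xi (p, i, j) ->
  0 < t -> tile_set xi (p, i, j) (e.1 + (1 / 2) *: xi e.2 + horizontal t) ->
  e = (p, i) \/ e = (p + xi i, j).
Proof.
move=> ij /(tile_edge_coords (1 / 2))[a [b [E H]]] t0 [a' [b' [/andP[a0 a1] /andP[b0 b1] E']]].
have [k [l [k0 l0 Hh]]] := horizontal_xi ij.
have [Ea Eb] : a - t * k = a' /\ b + t * l = b'.
  apply: (tile_coords ij _ E'); rewrite E Hh; apply: rv2P; rewrite !mxE; ring.
have tk0 : 0 < t * k by rewrite mulr_gt0.
have tl0 : 0 < t * l by rewrite mulr_gt0.
by clear E E' Hh; case: H => -[-> Ha Hb]; [left|exfalso; lra|right|exfalso; lra].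
Qed.

End Zonogon.

(** * Snakes as linear orders *)

Section Snakes.
Variables (R : realType) (n : nat) (xi : 'I_n -> 'rV[R]_2).
Local Open Scope ring_scope.
Implicit Types (p q : 'rV[R]_2) (i j k a b c d x y : 'I_n) (s : 'S_n).

(** The vertex at which the snake of s takes its edge of color c. *)
Definition prefix_sum s c : 'rV[R]_2 := \sum_(x | before s x c) xi x.

Fixpoint colored_edges p (cs : seq 'I_n) : seq (edge R n) :=
  if cs is c :: cs' then (p, c) :: colored_edges (p + xi c) cs' else [::].

Lemma colored_edges_colors p cs : [seq e.2 | e <- colored_edges p cs] = cs.
Proof. by elim: cs p => //= c cs IH p; rewrite IH. Qed.

Lemma directed_pathE T p q es : directed_path xi T p q es <->
  [/\ es = colored_edges p [seq e.2 | e <- es],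
      forall e, e \in es -> graph_edge xi T e
    & p + \sum_(c <- [seq e.2 | e <- es]) xi c = q].
Proof.
elim: es p => [|e es IH] p /=.
  split=> [->|[_ _ <-]]; rewrite big_nil addr0 //.
rewrite big_cons; split=> [[ge ep /IH[h1 h2 h3]]|[[ep h1] h2 h3]].
  split.
  - by rewrite -ep -h1; case: (e).
  - by move=> f; rewrite in_cons => /orP[/eqP->//|]; apply: h2.
  - by rewrite addrA -ep.
have ep' : e.1 = p by rewrite ep.
split=> //; first by apply: h2; rewrite mem_head.
apply/IH; rewrite ep'; split=> //; last by rewrite -addrA.
by move=> f fs; apply: h2; rewrite in_cons fs orbT.
Qed.

Lemma mem_colored_edges p cs e : uniq cs -> e \in colored_edges p cs ->
  e.2 \in cs /\ e.1 = p + \sum_(d <- cs | (index d cs < index e.2 cs)%N) xi d.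
Proof.
elim: cs p => //= c cs IH p /andP[ncs ucs].
rewrite in_cons => /orP[/eqP->|/(IH _ ucs)[ecs ->]] /=.
  by rewrite mem_head eqxx big_pred0 ?addr0.
have nce : c == e.2 = false by apply: contraNF ncs => /eqP->.
rewrite in_cons ecs orbT nce big_cons eqxx /= -addrA; split=> //; congr (_ + (_ + _)).
rewrite big_seq_cond [RHS]big_seq_cond; apply: eq_bigl => d.
case: (boolP (d \in cs)) => //= dcs.
by have -> : c == d = false by apply: contraNF ncs => /eqP->.
Qed.

Lemma has_colored_edge p cs c : c \in cs -> exists r, (r, c) \in colored_edges p cs.
Proof.
move=> h; have := h; rewrite -{1}(colored_edges_colors p cs) => /mapP[[r d] rd /= ->].
by exists r.
Qed.

Let word s := [seq s k | k <- enum 'I_n].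

Lemma index_word s x : index x (word s) = (s^-1)%g x :> nat.
Proof. by rewrite -{1}(permKV s x) index_map ?index_enum_ord //; exact: perm_inj. Qed.

Lemma sum_word (F : 'I_n -> 'rV[R]_2) (P : pred 'I_n) s :
  \sum_(d <- word s | P d) F d = \sum_(d | P d) F d.
Proof. by rewrite big_map big_enum_cond /= [RHS](reindex_inj (@perm_inj _ s)). Qed.

(** The points of a snake are determined by its colors. *)
Lemma SigmaP T s : Sigma xi T s <-> forall c, graph_edge xi T (prefix_sum s c, c).
Proof.
have uw : uniq (word s) by rewrite map_inj_uniq ?enum_uniq //; exact: perm_inj.
have mw c : c \in word s by apply/mapP; exists ((s^-1)%g c); rewrite ?mem_enum ?permKV.
have Eedge e : e \in colored_edges 0 (word s) -> e = (prefix_sum s e.2, e.2).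
  move=> /(mem_colored_edges uw)[_ E]; rewrite [LHS]surjective_pairing E add0r sum_word.
  by congr (_, _); apply: eq_bigl => d; rewrite !index_word.
split=> [[es [/directed_pathE[E ge _] Ew]] c|H].
  have [r hr] := has_colored_edge 0 (mw c).
  have := ge (r, c); rewrite E Ew => /(_ hr).
  by rewrite [(r, c)](Eedge _ hr).
exists (colored_edges 0 (word s)); split; last exact: colored_edges_colors.
apply/directed_pathE; rewrite colored_edges_colors; split=> //.
  by move=> e /Eedge->.
by rewrite add0r sum_word /top_vertex.
Qed.

Lemma prefix_sum_flips s a b s' : flips s a b s' ->
  [/\ prefix_sum s b = prefix_sum s a + xi a, prefix_sum s' b = prefix_sum s a,
      prefix_sum s' a = prefix_sum s a + xi b
    & forall c, c != a -> c != b -> prefix_sum s' c = prefix_sum s c].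
Proof.
move=> fl; have [ab sab _] := fl; have sba := flips_swapped fl.
have nab : a != b by rewrite -val_eqE ltn_eqF.
have nsba : before s b a = false by rewrite beforeN // sab.
have nsab : before s' a b = false by rewrite beforeN 1?eq_sym // sba.
split.
- rewrite /prefix_sum (bigD1 a) //= addrC; congr (_ + _); apply: eq_bigl => x.
  have [->|xa] := eqVneq x a; first by rewrite andbF before_irr.
  have [->|xb] := eqVneq x b; first by rewrite before_irr nsba.
  by rewrite andbT (flips_adjacent fl).
- apply: eq_bigl => x; have [->|xa] := eqVneq x a; first by rewrite nsab before_irr.
  have [->|xb] := eqVneq x b; first by rewrite before_irr nsba.
  by rewrite (flips_before fl) ?(flips_adjacent fl) // /same_pair (negbTE xa) (negbTE xb).
- rewrite /prefix_sum (bigD1 b) //= addrC; congr (_ + _); apply: eq_bigl => x.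
  have [->|xb] := eqVneq x b; first by rewrite andbF nsba.
  have [->|xa] := eqVneq x a; first by rewrite !before_irr.
  by rewrite andbT (flips_before fl) // /same_pair (negbTE xa) (negbTE xb).
- move=> c ca cb; apply: eq_bigl => x.
  by rewrite (flips_before fl) // /same_pair (negbTE ca) (negbTE cb) !andbF.
Qed.

Hypothesis xiP : zonogon_vectors xi.

Lemma sum_delta c (r : R) : \sum_x ((x == c)%:R * r) *: xi x = r *: xi c.
Proof.
rewrite (bigD1 c) //= eqxx mul1r big1 ?addr0 // => x /negbTE->.
by rewrite mul0r scale0r.
Qed.

Lemma prefix_sumE s c : prefix_sum s c = \sum_x (before s x c)%:R *: xi x.
Proof.
by rewrite /prefix_sum big_mkcond; apply: eq_bigr => x _; case: before; rewrite ?scale1r ?scale0r.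
Qed.

(** A pair cd that is not inverted in s leaves room to the right of the edge
    of color c: a move to the right lowers the coefficient of the smaller color
    and raises that of the larger one. *)
Lemma near_zonogon s c d : d != c -> ~~ inverted s c d ->
  near0 (fun t => zonogon xi (prefix_sum s c + (1 / 2) *: xi c + horizontal t)).
Proof.
move=> dc nin.
have main (r1 r2 : R) q : 0 <= 1 / 2 + r1 <= 1 -> 0 <= (before s d c)%:R + r2 <= 1 ->
    q = prefix_sum s c + (1 / 2) *: xi c + r1 *: xi c + r2 *: xi d -> zonogon xi q.
  move=> h1 h2 ->.
  exists (fun x => (before s x c)%:R + (x == c)%:R * (1 / 2) + (x == c)%:R * r1 + (x == d)%:R * r2).
  split=> [x|].
    have [->|xc] := eqVneq x c; first by rewrite before_irr (eq_sym c d) (negbTE dc) mulr0n mulr1n; lra.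
    have [->|xd] := eqVneq x d; first by rewrite !mul0r !addr0 mul1r.
    by rewrite !mul0r !addr0; case: before; rewrite ?mulr0n ?mulr1n; lra.
  rewrite prefix_sumE -!sum_delta -!big_split /=; apply: eq_bigr => x _.
  by rewrite -!scalerDl.
have [lt|lt|E] := ltngtP c d; last by move: dc; rewrite (val_inj E) eqxx.
  have [k [l [k0 l0 H]]] := horizontal_xi xiP lt.
  exists (Num.min (k^-1 / 2) (l^-1 / 2)); first by rewrite lt_min !divr_gt0 ?invr_gt0.
  move=> t t0; rewrite le_min => /andP[tk tl].
  have tk1 : t * k <= 1 / 2 by rewrite -ler_pdivlMr // mul1r mulrC.
  have tl1 : t * l <= 1 / 2 by rewrite -ler_pdivlMr // mul1r mulrC.
  have tk0 : 0 < t * k by rewrite mulr_gt0.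
  have tl0 : 0 < t * l by rewrite mulr_gt0.
  have h1 : 0 <= 1 / 2 - t * k <= 1 by lra.
  have h2 : 0 <= 0 + t * l <= 1 by lra.
  move: nin; rewrite /inverted lt negbK => bcd.
  have ndc : before s d c = false by rewrite beforeN 1?eq_sym // bcd.
  by apply: (main (- (t * k)) (t * l)); [exact: h1 | rewrite ndc; exact: h2 | rewrite H !addrA].
have [k [l [k0 l0 H]]] := horizontal_xi xiP lt.
exists (Num.min (k^-1 / 2) (l^-1 / 2)); first by rewrite lt_min !divr_gt0 ?invr_gt0.
move=> t t0; rewrite le_min => /andP[tk tl].
have tk1 : t * k <= 1 / 2 by rewrite -ler_pdivlMr // mul1r mulrC.
have tl1 : t * l <= 1 / 2 by rewrite -ler_pdivlMr // mul1r mulrC.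
have tk0 : 0 < t * k by rewrite mulr_gt0.
have tl0 : 0 < t * l by rewrite mulr_gt0.
have h1 : 0 <= 1 / 2 + t * l <= 1 by lra.
have h2 : 0 <= 1 - t * k <= 1 by lra.
move: nin; rewrite /inverted ltnNge ltnW //= -beforeN 1?eq_sym // => bdc.
apply: (main (t * l) (- (t * k))); [exact: h1 | by rewrite bdc; exact: h2 | ].
by rewrite H [X in _ + X]addrC !addrA.
Qed.

Lemma det2_sum (f : 'I_n -> R) w : det2 (\sum_x f x *: xi x) w = \sum_x f x * det2 (xi x) w.
Proof.
rewrite /det2 !summxE !mulr_suml -sumrB; apply: eq_bigr => x _.
by rewrite !mxE; ring.
Qed.

(** If all pairs containing c are inverted in s, the snake follows there the
    right boundary of the zonogon. *)
Lemma det_xi_sum_max s c (f : 'I_n -> R) : (forall d, d != c -> inverted s c d) ->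
  (forall x, 0 <= f x <= 1) -> det2 (\sum_x f x *: xi x) (xi c) <= det2 (prefix_sum s c) (xi c).
Proof.
move=> bad f01; rewrite prefix_sumE !det2_sum; apply: ler_sum => x _.
have /andP[f0 f1] := f01 x.
have [lt|lt|E] := ltngtP x c.
- have xc : x != c by rewrite -val_eqE ltn_eqF.
  have := bad x xc; rewrite /inverted ltnNge ltnW //= => bcx.
  rewrite beforeN 1?eq_sym // bcx mul0r mulr_ge0_le0 //.
  by apply/ltW/det_xi.
- have xc : x != c by rewrite -val_eqE gtn_eqF.
  have := bad x xc; rewrite /inverted lt /= -beforeN 1?eq_sym // => ->.
  have D := det_xi xiP lt.
  have D' : 0 < det2 (xi x) (xi c) by move: D; rewrite /det2; lra.
  by rewrite ler_wpM2r // ltW.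
- have -> : det2 (xi x) (xi c) = 0 by rewrite (val_inj E) /det2; ring.
  by rewrite !mulr0.
Qed.

Lemma zonogon_height q : zonogon xi q -> 0 <= q 0 1 <= top_vertex xi 0 1.
Proof.
case=> f [f01 ->]; rewrite /top_vertex !summxE; apply/andP; split.
  by apply: sumr_ge0 => x _; rewrite mxE mulr_ge0 ?(ltW (xiY_gt0 xiP _)) //; case/andP: (f01 x).
apply: ler_sum => x _; rewrite mxE ler_piMl ?(ltW (xiY_gt0 xiP _)) //; by case/andP: (f01 x).
Qed.

Lemma prefix_sum_first s c : (forall x, before s x c = false) -> prefix_sum s c = 0.
Proof. by move=> h; rewrite /prefix_sum big_pred0. Qed.

Lemma prefix_sum_last s c : (forall x, x != c -> before s x c) ->
  prefix_sum s c + xi c = top_vertex xi.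
Proof.
move=> h; rewrite /top_vertex (bigD1 c) //= addrC; congr (_ + _); apply: eq_bigl => x.
by have [->|/h->] := eqVneq x c; rewrite ?before_irr.
Qed.

Lemma prefix_sum_next s (e : 'I_n.-1) :
  prefix_sum s (s (pos1 e)) = prefix_sum s (s (pos0 e)) + xi (s (pos0 e)).
Proof.
rewrite /prefix_sum (bigD1 (s (pos0 e))) /=; last by rewrite /before !permK pos1E.
rewrite addrC; congr (_ + _); apply: eq_bigl => x.
rewrite -(permKV s x) (inj_eq perm_inj) /before !permK pos1E -val_eqE /=.
by clear; lia.
Qed.

End Snakes.

(** * Snakes of a rhombus tiling *)

Section Tilings.
Variables (R : realType) (n : nat) (xi : 'I_n -> 'rV[R]_2).
Hypothesis xiP : zonogon_vectors xi.
Local Open Scope ring_scope.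
Implicit Types (p q w : 'rV[R]_2) (i j k a b c d x y : 'I_n) (s : 'S_n).
Variable T : seq (tile R n).
Hypotheses (TP : rhombus_tiling xi T) (n1 : n <> 1%N).

Local Notation prefix_sum := (prefix_sum xi).
Local Notation hz := (@horizontal R).

Let Tlt p i j : (p, i, j) \in T -> (i < j)%N.
Proof. by case: TP => + _ _; apply. Qed.
Let Tcover q : zonogon xi q <-> exists2 t, t \in T & tile_set xi t q.
Proof. by case: TP => _ + _; apply. Qed.

Lemma tiles_meet t t' q : t \in T -> t' \in T -> t != t' ->
  tile_set xi t q -> tile_set xi t' q -> meet_properly xi t t'.
Proof. by case: TP => _ _ H tT t'T ne tq t'q; apply: H => //; exists q. Qed.

(** Two different tiles share at most an edge, and no edge is horizontal. *)
Lemma tile_unique t t' q (e : R) : t \in T -> t' \in T -> e != 0 ->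
  tile_set xi t q -> tile_set xi t' q ->
  tile_set xi t (q + hz e) -> tile_set xi t' (q + hz e) -> t = t'.
Proof.
move=> tT t'T e0 h1 h2 h3 h4; apply/eqP; apply: contraT => ne; exfalso.
have m1 : (tile_set xi t `&` tile_set xi t')%classic q by split.
have m2 : (tile_set xi t `&` tile_set xi t')%classic (q + hz e) by split.
have [[v [_ _ E]]|[f [_ _ E]]] := tiles_meet tT t'T ne h1 h2; rewrite E in m1 m2.
  rewrite /= in m1 m2; move: m2; rewrite -m1.
  move=> /(congr1 (fun v : 'rV[R]_2 => v 0 0)); rewrite mxE horizontalX => He.
  by move/eqP: e0; apply; apply: (addrI (q 0 0)); rewrite He addr0.
case: m1 m2 => r [_ Er] [r' [_ Er']].
have Y0 := xiY_gt0 xiP f.2.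
have EY := congr1 (fun v : 'rV[R]_2 => v 0 1) Er'.
have EX := congr1 (fun v : 'rV[R]_2 => v 0 0) Er'.
rewrite Er !mxE horizontalY addr0 in EY; rewrite Er !mxE horizontalX in EX.
have Err : r = r'.
  by apply: (mulIf (lt0r_neq0 Y0)); apply: (addrI (f.1 0 1)).
by move/eqP: e0; apply; rewrite Err in EX; apply: (addrI (f.1 0 0 + r' * xi f.2 0 0)); rewrite EX addr0.
Qed.

Definition is_snake s := forall c, graph_edge xi T (prefix_sum s c, c).

Lemma snake_tile s c : is_snake s ->
  exists2 t, t \in T & (prefix_sum s c, c) \in tile_edges xi t.
Proof. by move=> /(_ c)[//|[]]. Qed.

(** The tile to the right of the edge of color c has it as its lower,
    respectively upper, left edge. *)
Definition lower_left s c := exists2 d : 'I_n, (c < d)%N & (prefix_sum s c, c, d) \in T.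
Definition upper_left s c := exists2 d : 'I_n, (d < c)%N & (prefix_sum s c - xi d, d, c) \in T.

(** The points just to the right of the middle of the edge are covered by
    tiles; as there are finitely many tiles, and these are closed, one of them
    contains both such a point and the middle. It meets every tile having the
    edge properly, so the edge is one of its own. *)
Lemma edge_right_tile s c d : is_snake s -> d != c -> ~~ inverted s c d ->
  lower_left s c \/ upper_left s c.
Proof.
move=> sn dc nin; set m := prefix_sum s c + (1 / 2) *: xi c.
have closed : near0 (fun e => forall t, t \in T -> tile_set xi t (m + hz e) -> tile_set xi t m).
  by apply: near0_all => -[[p i] j] tT; apply: tile_closed_right => //; apply: Tlt tT.
have [e e0 [ze cle]] := near0_ex (near0_and (near_zonogon xiP dc nin) closed).
have [[[p i] j] tT te] := (Tcover _).1 ze; have tm := cle _ tT te.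
have [[[p' i'] j'] t'T ed] := snake_tile c sn.
have ij := Tlt tT; have i'j' := Tlt t'T.
have edt : (prefix_sum s c, c) \in tile_edges xi (p, i, j).
  have [->//|ne] := eqVneq (p, i, j) (p', i', j').
  have t'm := tile_edge_mid ed.
  have mm : (tile_set xi (p, i, j) `&` tile_set xi (p', i', j'))%classic m by split.
  have [[v [_ vt' E]]|[f [ft ft' E]]] := tiles_meet tT t'T ne tm t'm; rewrite E in mm.
    have := tile_edge_mid_vertex xiP i'j' ed; rewrite /= -/m.
    by rewrite (mm : m = v) vt'.
  by rewrite (tile_edge_mid_unique xiP i'j' ed ft' mm).
case: (tile_edge_left xiP ij edt e0 te) => -[E1 E2].
  by left; exists j; [rewrite E2 | rewrite E1 E2].
by right; exists i; [rewrite E2 | rewrite E1 addrK E2].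
Qed.

Lemma no_left_vertex_on_boundary s c p i j : (forall d, d != c -> inverted s c d) ->
  (p, i, j) \in T -> p + xi i = prefix_sum s c \/ p + xi i = prefix_sum s c + xi c -> False.
Proof.
move=> bad tT pE; have [e e0 te] := near0_ex (tile_left_vertex xiP p (Tlt tT)).
have [f [f01 fE]] : zonogon xi (p + xi i + hz e) by apply/Tcover; exists (p, i, j).
have := det_xi_sum_max xiP bad f01; rewrite -fE.
have Y0 := xiY_gt0 xiP c.
have eY : 0 < e * xi c 0 1 by rewrite mulr_gt0.
clear fE; case: pE => ->; rewrite /det2 !mxE horizontalX horizontalY => h;
  clear te; nra.
Qed.

(** Along the snake consider the edges off the right boundary. A lower left
    edge is neither last nor followed by a boundary edge, and an upper left
    edge is neither first nor preceded by a boundary edge, since the tile would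
    leave the zonogon. So if no lower left edge were followed by an upper left
    edge, there would be no lower left edges, then no upper left edges, and the
    snake would be the right boundary. *)
Lemma lower_upper_exists s c d : is_snake s -> d != c -> ~~ inverted s c d ->
  exists e : 'I_n.-1, lower_left s (s (pos0 e)) /\ upper_left s (s (pos1 e)).
Proof.
move=> sn dc nin; case: (pselect (exists e : 'I_n.-1, lower_left s (s (pos0 e)) /\ upper_left s (s (pos1 e)))) => // nLU; exfalso.
have LUB x : [\/ lower_left s x, upper_left s x | forall y, y != x -> inverted s x y].
  case: (pselect (forall y, y != x -> inverted s x y)); first by constructor 3.
  move=> /existsNP[y /not_implyP[yx /negP h]].
  by case: (edge_right_tile sn yx h); [constructor 1 | constructor 2].
have tile_in q t : t \in T -> tile_set xi t q -> zonogon xi q by move=> *; apply/Tcover; exists t.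
have noL m : forall x, (n - (s^-1)%g x <= m)%N -> ~ lower_left s x.
  elim: m => [|m IH] x le; first by have := ltn_ord ((s^-1)%g x); move: le; clear; lia.
  move=> Lx; have [y xy tT] := Lx.
  have [h|h] := ltnP (((s^-1)%g x).+1) n; last first.
    have /(zonogon_height xiP) : zonogon xi (prefix_sum s x + xi x + xi y).
      apply: (tile_in _ _ tT); exists 1, 1; split; rewrite ?ler01 ?lexx //.
      by rewrite !scale1r.
    rewrite prefix_sum_last; first by have := xiY_gt0 xiP y; rewrite mxE; lra.
    move=> z zx; have : (s^-1)%g z != (s^-1)%g x by rewrite (inj_eq perm_inj).
    by rewrite -val_eqE /before /=; have := ltn_ord ((s^-1)%g z); move: h; clear; lia.
  have h' : ((s^-1)%g x < n.-1)%N by move: h; clear; lia.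
  pose e := Ordinal h'; have e0 : pos0 e = (s^-1)%g x by apply: val_inj.
  have ex : s (pos0 e) = x by rewrite e0 permKV.
  case: (LUB (s (pos1 e))) => [L'|U'|bad].
  - apply: (IH (s (pos1 e))) => //; rewrite permK pos1E /=; move: le h; clear; lia.
  - by apply: nLU; exists e; rewrite ex.
  - by apply: (no_left_vertex_on_boundary bad tT); left; rewrite prefix_sum_next ex.
have noU m : forall x, ((s^-1)%g x <= m)%N -> ~ upper_left s x.
  elim: m => [|m IH] x le [y yx tT].
    have /(zonogon_height xiP) : zonogon xi (prefix_sum s x - xi y).
      apply: (tile_in _ _ tT); exists 0, 0; split; rewrite ?ler01 ?lexx //.
      by rewrite !scale0r !addr0.
    rewrite prefix_sum_first; first by have := xiY_gt0 xiP y; rewrite !mxE; lra.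
    by move=> z; rewrite /before; move: le; clear; lia.
  have [h|h] := posnP (((s^-1)%g x)); first by apply: (IH x); rewrite ?h //; exists y.
  have h' : (((s^-1)%g x).-1 < n.-1)%N by have := ltn_ord ((s^-1)%g x); move: h; clear; lia.
  pose e := Ordinal h'; have e1 : pos1 e = (s^-1)%g x.
    by apply: val_inj; apply: etrans (pos1E e) _; rewrite /= prednK.
  have ex : s (pos1 e) = x by rewrite e1 permKV.
  case: (LUB (s (pos0 e))) => [L'|U'|bad].
  - exact: noL L'.
  - by apply: (IH (s (pos0 e))) => //; rewrite permK /=; move: le h; clear; lia.
  - by apply: (no_left_vertex_on_boundary bad tT); right; rewrite subrK -prefix_sum_next ex.
case: (LUB c) => [/(noL n)|/(noU n)|/(_ d dc)]; last by move/negP: nin.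
  by apply; rewrite leq_subr.
by apply; rewrite ltnW.
Qed.

(** The tiles of the two edges found by the previous lemma have the same left
    vertex, hence they are equal, and the snake can pass on its other side. *)
Theorem right_flip s c d : is_snake s -> d != c -> ~~ inverted s c d ->
  exists a b s', [/\ flips s a b s', is_snake s' & (prefix_sum s a, a, b) \in T].
Proof.
move=> sn dc nin; have [e [[y ay t1T] [z zb t2T]]] := lower_upper_exists sn dc nin.
set a := s (pos0 e) in ay t1T *; set b := s (pos1 e) in zb t2T *.
have next := prefix_sum_next xi s e; rewrite -/a -/b in next.
have [r r0 [h1 h2]] := near0_ex (near0_and (tile_left_vertex xiP (prefix_sum s a) ay)
   (tile_left_vertex xiP (prefix_sum s b - xi z) zb)).
rewrite subrK next in h2; rewrite next in t2T h2.
have [_ Eaz Eyb] : (prefix_sum s a, a, y) = (prefix_sum s a + xi a - xi z, z, b).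
  apply: (tile_unique (q := prefix_sum s a + xi a) t1T t2T (lt0r_neq0 r0)) => //.
  - by exists 1, 0; rewrite ?ler01 ?lexx scale1r scale0r addr0.
  - by exists 1, 0; rewrite ?ler01 ?lexx scale1r scale0r addr0 subrK.
rewrite Eyb in ay t1T.
have fl : flips s a b (std_transp e * s)%g by apply: std_flips.
exists a, b, (std_transp e * s)%g; split=> // x.
have [_ Pb Pa Px] := prefix_sum_flips xi fl.
have [->|xa] := eqVneq x a.
  by left; exists (prefix_sum s a, a, b) => //; rewrite Pa !inE eqxx !orbT.
have [->|xb] := eqVneq x b.
  by left; exists (prefix_sum s a, a, b) => //; rewrite Pb !inE eqxx !orbT.
by rewrite Px.
Qed.

(** The tile with colors j and d whose right edge of color j starts at p, and
    the lower end of its left edge of color j. *)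
Definition strip_tile j p d : tile R n := if (j < d)%N then (p - xi d, j, d) else (p, d, j).
Definition strip_prev j p d : 'rV[R]_2 := if (j < d)%N then p - xi d else p + xi d.

(** The list l gives the other colors of the tiles of the j-strip, read to the
    left from the edge at p to the edge at q. *)
Fixpoint strip j p (l : seq 'I_n) q : Prop :=
  if l is d :: l' then
    [/\ d != j, strip_tile j p d \in T & strip j (strip_prev j p d) l' q]
  else p = q.

Lemma strip_cat j p l1 l2 q : (exists r, strip j p l1 r /\ strip j r l2 q) -> strip j p (l1 ++ l2) q.
Proof.
elim: l1 p => [|d l1 IH] p /= [r]; first by case=> ->.
by case=> -[dj tT h1] h2; split=> //; apply: IH; exists r.
Qed.

(** Both tiles contain the middle of the edge and a point to its left. *)
Lemma strip_tile_unique j p d d' : d != j -> d' != j ->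
  strip_tile j p d \in T -> strip_tile j p d' \in T -> d = d'.
Proof.
move=> dj d'j.
have H x : x != j -> strip_tile j p x \in T -> near0 (fun t =>
    tile_set xi (strip_tile j p x) (p + (1 / 2) *: xi j) /\
    tile_set xi (strip_tile j p x) (p + (1 / 2) *: xi j - hz t)).
  rewrite /strip_tile; case: ltnP => [jx xj tT|xj' xj tT].
    by have := @tile_right_edge _ _ _ xiP (p - xi x) j x (p, j) jx; apply; right; rewrite subrK.
  have xj2 : (x < j)%N by rewrite ltn_neqAle xj' andbT.
  by have := @tile_right_edge _ _ _ xiP p x j (p, j) xj2; apply; left.
move=> tT t'T; have [e e0 [[h1 h2] [h3 h4]]] := near0_ex (near0_and (H _ dj tT) (H _ d'j t'T)).
set m := p + _ in h1 h2 h3 h4.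
have : strip_tile j p d = strip_tile j p d'.
  apply: (tile_unique (q := m - hz e) (e := e)) => //; rewrite ?subrK //.
  exact: lt0r_neq0.
rewrite /strip_tile; case: ifP => jd; case: ifP => jd' [] //.
  by move=> _ E _; move: dj d'j; rewrite E eqxx.
by move=> _ E _; move: dj d'j; rewrite E eqxx.
Qed.

Lemma strip_prefix j p l l' q q' : strip j p l q -> strip j p l' q' ->
  prefix l l' \/ prefix l' l.
Proof.
elim: l p l' => [|d l IH] p [|d' l'] /=; try by [left | right].
move=> [dj tT h] [d'j t'T h']; have E := strip_tile_unique dj d'j tT t'T.
by subst d'; rewrite /= eqxx; apply: IH h h'.
Qed.

(** Pushing the snake to the right boundary, its edge of color j crosses one
    tile for every d that is not yet inverted with j. *)
Lemma snake_strip s j : is_snake s -> exists l, strip j (prefix_sum (omega n) j) l (prefix_sum s j) /\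
  forall d, d != j -> (d \in l) = ~~ inverted s j d.
Proof.
have [m] := ubnP (#|~: Inv s|); elim: m s => // m IH s lem sn.
have [/existsP[c /existsP[d /andP[dc nin]]]|all_inv] :=
  boolP [exists c, exists d, (d != c) && ~~ inverted s c d]; last first.
  have inv c d : d != c -> inverted s c d.
    move=> dc; apply: contraNT all_inv => nin.
    by apply/existsP; exists c; apply/existsP; exists d; rewrite dc.
  have -> : s = omega n.
    by apply: eq_inverted => x y xy; rewrite inverted_omega // inv // eq_sym.
  by exists [::]; split=> // d dj; rewrite inverted_omega 1?eq_sym.
have [a [b [s' [fl sn' tT]]]] := right_flip sn dc nin.
have [ab sab E] := fl; have nab : a != b by rewrite -val_eqE ltn_eqF.
have nba : b != a by rewrite eq_sym.
have [EI nI] := flips_Inv fl.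
have [|l' [h' l'P]] := IH s' _ sn'.
  rewrite ltnS in lem; apply: leq_trans lem; rewrite EI; apply: proper_card; apply/properP; split.
    by rewrite finset.setCS subsetU1.
  by exists (a, b); rewrite finset.in_setC // negbK setU11.
have [Pb P'b P'a P'x] := prefix_sum_flips xi fl.
have nsab : inverted s a b = false by rewrite /inverted ab sab.
have [ja|ja] := eqVneq j a.
  subst j; exists (rcons l' b); split.
    rewrite -cats1; apply: strip_cat; exists (prefix_sum s' a); split=> //=.
    by rewrite /strip_tile /strip_prev ab P'a addrK eq_sym.
  move=> d' d'a; rewrite mem_rcons in_cons l'P // E 1?eq_sym // negb_or /same_pair eqxx (negbTE nab) /= orbF.
  by have [->|_] := eqVneq d' b; rewrite ?nsab //= andbT.
have [jb|jb] := eqVneq j b.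
  subst j; exists (rcons l' a); split.
    rewrite -cats1; apply: strip_cat; exists (prefix_sum s' b); split=> //=.
    by rewrite /strip_tile /strip_prev ltnNge ltnW //= P'b.
  move=> d' d'b; rewrite mem_rcons in_cons l'P // E 1?eq_sym // negb_or /same_pair eqxx (negbTE nba) /=.
  have [->|_] := eqVneq d' a; last by rewrite andbT.
  by rewrite -(invertedC s nab) nsab.
exists l'; split; first by rewrite -P'x.
by move=> d' d'j; rewrite l'P // E 1?eq_sym // /same_pair (negbTE ja) (negbTE jb) orbF.
Qed.

End Tilings.

(** The lists of two snakes start at the same edge of the right boundary, so
    one is a prefix of the other. If j is least in s and greatest in t, then k
    is only in the list of s and i is only in the list of t. *)
Theorem tiling_separated (R : realType) (n : nat) (xi : 'I_n -> 'rV[R]_2) (T : seq (tile R n)) :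
  zonogon_vectors xi -> rhombus_tiling xi T -> separated (Sigma xi T).
Proof.
move=> xiP TP i j k /andP[ij jk] s t /SigmaP ss /SigmaP ts sji sjk tij tkj.
have n1 : n <> 1%N by have := ltn_ord k; move: ij jk; clear; lia.
have [nij njk] : i != j /\ j != k by rewrite -!val_eqE !ltn_eqF.
have nji : j != i by rewrite eq_sym.
have nkj : k != j by rewrite eq_sym.
have [l [hl lP]] := snake_strip xiP TP n1 j ss.
have [l' [hl' l'P]] := snake_strip xiP TP n1 j ts.
have ngt : (j < i)%N = false by rewrite ltnNge ltnW.
have il : (i \in l) = false by rewrite lP // /inverted ngt sji.
have kl : k \in l by rewrite lP // /inverted jk sjk.
have il' : i \in l'.
  by rewrite l'P // /inverted ngt /= -beforeN.
have kl' : (k \in l') = false.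
  by rewrite l'P // /inverted jk /= negbK beforeN // tkj.
case: (strip_prefix xiP TP hl hl') => /prefixP[r E].
  by move: kl'; rewrite E mem_cat kl.
by move: il; rewrite E mem_cat il'.
Qed.

(** * The tiling of a ranking *)

Section RankingTiling.
Variables (R : realType) (n : nat) (xi : 'I_n -> 'rV[R]_2).
Hypothesis xiP : zonogon_vectors xi.
Local Open Scope ring_scope.
Variable rk : 'I_n -> 'I_n -> nat.
Hypothesis rkP : admissible rk.
Implicit Types (p q w : 'rV[R]_2) (i j k l a b c d x y z : 'I_n) (s : 'S_n).

Let rkC x y : rk x y = rk y x. Proof. by case: rkP. Qed.
Let rk_inj i j k l : (i < j)%N -> (k < l)%N -> rk i j = rk k l -> i = k /\ j = l.
Proof. by case: rkP => _ _; apply. Qed.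

Lemma rk_same_pair x y a b : (a < b)%N -> x != y -> (rk x y == rk a b) = same_pair x y a b.
Proof.
move=> ab xy; apply/eqP/idP => [E|]; last first.
  by case/orP => /andP[/eqP-> /eqP->]; rewrite ?(rkC b a).
have [lt|lt|E'] := ltngtP x y; last by move: xy; rewrite (val_inj E') eqxx.
  by case: (rk_inj lt ab E) => -> ->; rewrite /same_pair !eqxx.
by rewrite rkC in E; case: (rk_inj lt ab E) => -> ->; rewrite /same_pair !eqxx orbT.
Qed.

Lemma crossing_ex m : {s | conforms rk s /\ forall x y, x != y -> inverted s x y = (rk x y < m)%N}.
Proof.
apply: cid; apply: (@perm_of_closed n rk rkP (fun x y => (rk x y < m)%N)) => [x y|x y z _ _ _].
  by rewrite rkC.
exact: ltn_trans.
Qed.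

Definition at_rank m : 'S_n := sval (crossing_ex m).

Lemma at_rank_conforms m : conforms rk (at_rank m).
Proof. exact: (svalP (crossing_ex m)).1. Qed.

Lemma inverted_at_rank m x y : x != y -> inverted (at_rank m) x y = (rk x y < m)%N.
Proof. exact: (svalP (crossing_ex m)).2. Qed.

Lemma at_rank_flips i j : (i < j)%N -> flips (at_rank (rk i j)) i j (at_rank (rk i j).+1).
Proof.
move=> ij; have nij : i != j by rewrite -val_eqE ltn_eqF.
split=> // [|x y xy]; first by rewrite before_inv ij inverted_at_rank // ltnn.
by rewrite !inverted_at_rank // ltnS leq_eqVlt rk_same_pair // orbC.
Qed.

Definition rank_tile i j : tile R n := (prefix_sum xi (at_rank (rk i j)) i, i, j).
Definition rank_tiling : seq (tile R n) :=
  [seq rank_tile e.1 e.2 | e : 'I_n * 'I_n <- enum {: 'I_n * 'I_n} & (e.1 < e.2)%N].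

Lemma mem_rank_tiling t : reflect (exists i j, (i < j)%N /\ t = rank_tile i j) (t \in rank_tiling).
Proof.
apply: (iffP mapP) => [[[i j]]|[i [j [ij ->]]]].
  by rewrite mem_filter => /andP[/= ij _] ->; exists i, j.
by exists (i, j); rewrite // mem_filter mem_enum ij.
Qed.

Definition below i j x := before (at_rank (rk i j)) x i.

(** The tiles are faces of the n-cube, projected to the plane. *)
Definition face i j (A : 'I_n -> R) : Prop :=
  (forall x, 0 <= A x <= 1) /\ (forall x, x != i -> x != j -> A x = (below i j x)%:R).

Definition proj (A : 'I_n -> R) : 'rV[R]_2 := \sum_x A x *: xi x.

Lemma belowE i j x : (i < j)%N -> [/\ below i j i = false, below i j j = false &
  x != i -> x != j -> before (at_rank (rk i j)) x j = below i j x].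
Proof.
move=> ij; have fl := at_rank_flips ij; have nij : i != j by rewrite -val_eqE ltn_eqF.
split; rewrite /below; first exact: before_irr.
  by rewrite beforeN //; have [_ -> _] := fl.
by move=> xi' xj; apply: (flips_adjacent fl).
Qed.

Lemma proj_face i j A : (i < j)%N -> face i j A ->
  proj A = prefix_sum xi (at_rank (rk i j)) i + A i *: xi i + A j *: xi j.
Proof.
move=> ij [_ AE]; have nij : i != j by rewrite -val_eqE ltn_eqF.
have [bi bj _] := belowE i ij.
rewrite prefix_sumE /proj (bigD1 i) //= (bigD1 j) 1?eq_sym //=.
rewrite [in RHS](bigD1 i) //= [in RHS](bigD1 j) 1?eq_sym //=.
rewrite -/(below i j i) -/(below i j j) bi bj !scale0r !add0r addrA addrC addrA; congr (_ + _ + _).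
by apply: eq_bigr => x /andP[xi' xj]; rewrite AE.
Qed.

Lemma rank_tile_set i j q : (i < j)%N ->
  tile_set xi (rank_tile i j) q <-> exists2 A, face i j A & q = proj A.
Proof.
move=> ij; have nij : i != j by rewrite -val_eqE ltn_eqF.
have nji : j != i by rewrite eq_sym.
split=> [[a [b [a01 b01 ->]]]|[A fA ->]]; last first.
  exists (A i), (A j); split; [exact: fA.1|exact: fA.1|exact: proj_face].
pose A x := if x == i then a else if x == j then b else (below i j x)%:R.
have fA : face i j A.
  split=> x; rewrite /A; last by move=> /negbTE-> /negbTE->.
  by case: eqP => // _; case: eqP => // _; case: below; rewrite ?lexx ?ler01.
by exists A => //; rewrite (proj_face ij fA) /A !eqxx (negbTE nji).
Qed.

(** A tile is bounded by two snakes that differ only in the order of its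
    colors. One of them puts y after all colors that have a positive
    coordinate, if the coordinate of y is not 1. *)
Lemma face_before i j A y : (i < j)%N -> face i j A -> A y < 1 ->
  exists2 s, conforms rk s & forall x, x != y -> 0 < A x -> before s x y.
Proof.
move=> ij [_ AE] Ay; set o := at_rank (rk i j); set o' := at_rank (rk i j).+1.
have fl : flips o i j o' by apply: at_rank_flips.
have [_ oij _] := fl; have oji := flips_swapped fl.
have low x : x != i -> x != j -> 0 < A x -> before o x i.
  by move=> xi' xj; rewrite AE // -/(below i j x) /below -/o; case: before; rewrite ?ltxx.
have adj x : x != i -> x != j -> before o x j = before o x i.
  exact: (flips_adjacent fl).
have [yi|yi] := eqVneq y i.
  subst y; exists o'; first exact: at_rank_conforms.
  move=> x xi' Ax; have [->//|xj] := eqVneq x j.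
  by rewrite (flips_before fl) ?low // /same_pair (negbTE xi') (negbTE xj).
exists o; first exact: at_rank_conforms.
have [yj|yj] := eqVneq y j.
  subst y => x xj Ax; have [->//|xi'] := eqVneq x i.
  by rewrite adj // low.
have iy : before o i y.
  rewrite beforeN //; apply/negP => h; move: Ay; rewrite AE // /below -/o h.
  by rewrite ltxx.
have jy : before o j y by rewrite beforeN // adj // -beforeN.
move=> x xy Ax; have [->//|xi'] := eqVneq x i; have [->//|xj] := eqVneq x j.
exact: before_trans (low _ xi' xj Ax) iy.
Qed.

Lemma face_after i j A y : (i < j)%N -> face i j A -> 0 < A y ->
  exists2 s, conforms rk s & forall x, x != y -> A x < 1 -> before s y x.
Proof.
move=> ij [_ AE] Ay; set o := at_rank (rk i j); set o' := at_rank (rk i j).+1.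
have fl : flips o i j o' by apply: at_rank_flips.
have [_ oij _] := fl; have oji := flips_swapped fl.
have adj x : x != i -> x != j -> before o x j = before o x i.
  exact: (flips_adjacent fl).
have high x : x != i -> x != j -> A x < 1 -> before o i x.
  move=> xi' xj; rewrite AE // /below -/o (@beforeN _ o x i) //.
  by case: before; rewrite ?ltxx.
have highj x : x != i -> x != j -> A x < 1 -> before o j x.
  move=> xi' xj Ax; rewrite beforeN // adj // -beforeN //; exact: high.
have [yj|yj] := eqVneq y j.
  subst y; exists o'; first exact: at_rank_conforms.
  move=> x xj Ax; have [->//|xi'] := eqVneq x i.
  by rewrite (flips_before fl) ?highj // /same_pair (negbTE xi') (negbTE xj) !andbF.
exists o; first exact: at_rank_conforms.
have [yi|yi] := eqVneq y i.
  subst y => x xi' Ax; have [->//|xj] := eqVneq x j.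
  exact: high.
have yo : before o y i.
  by move: Ay; rewrite AE // /below -/o; case: before; rewrite ?ltxx.
have yoj : before o y j by rewrite adj.
move=> x xy Ax; have [->//|xi'] := eqVneq x i; have [->//|xj] := eqVneq x j.
exact: before_trans yo (high _ xi' xj Ax).
Qed.

(** The vectors are in convex position in a half-plane: if no positive
    coefficient followed a negative one, the vector of the first negative
    coefficient would separate the positive part of the sum from its negative
    part. *)
Lemma sign_changes_pos (D : 'I_n -> R) m : \sum_x D x *: xi x = 0 -> 0 < D m -> (forall x, (x < m)%N -> D x = 0) ->
  exists i j k, (i < j < k)%N /\ [/\ 0 < D i, D j < 0 & 0 < D k].
Proof.
  move=> D0 Dm Dlow.
  case: (pselect (exists j k, [/\ (j < k)%N, D j < 0 & 0 < D k])) => [[j [k [jk Dj Dk]]]|no].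
    exists m, j, k; split=> //; rewrite jk andbT ltnNge leq_eqVlt; apply/negP => /orP[/eqP/val_inj E|lt].
      by move: Dj; rewrite E; lra.
    by rewrite Dlow // ltxx in Dj.
  exfalso; have [x0 Dx0] : exists x, D x < 0.
    apply/existsP; apply: contraT => /existsPn pos.
    have Y : 0 < \sum_x D x * xi x 0 1.
      rewrite (bigD1 m) //= ltr_wpDr ?mulr_gt0 ?xiY_gt0 // sumr_ge0 // => x _.
      by apply: mulr_ge0; [rewrite leNgt pos | apply/ltW/xiY_gt0].
    move: (congr1 (fun v : 'rV[R]_2 => v 0 1) D0); rewrite summxE mxE => E.
    move: Y; rewrite (eq_bigr (fun x => (D x *: xi x) 0 1)) ?E ?ltxx // => x _; by rewrite mxE.
  have [c Dc cmin] := @arg_minnP _ x0 (fun x => D x < 0) (fun x : 'I_n => x : nat) Dx0.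
  have lowc x : (x < c)%N -> 0 <= D x.
    by move=> xc; rewrite leNgt; apply/negP => /cmin; rewrite leqNgt xc.
  have highc x : (c < x)%N -> D x <= 0.
    by move=> cx; rewrite leNgt; apply/negP => Dx; apply: no; exists c, x.
  have mc : (m < c)%N.
    rewrite ltnNge leq_eqVlt; apply/negP => /orP[/eqP/val_inj E|lt].
      by move: Dc; rewrite E; lra.
    by rewrite Dlow // ltxx in Dc.
  have : \sum_x D x * det2 (xi x) (xi c) < 0.
    rewrite (bigD1 m) //= ltr_wnDr //; last by rewrite pmulr_rlt0 // det_xi.
    apply: sumr_le0 => x _; have [lt|lt|E] := ltngtP x c.
    - by rewrite mulr_ge0_le0 ?lowc // ltW // det_xi.
    - have Dt := det_xi xiP lt; rewrite mulr_le0_ge0 ?highc //.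
      by move: Dt; rewrite /det2; lra.
    - have -> : det2 (xi x) (xi c) = 0 by rewrite (val_inj E) /det2; ring.
      by rewrite mulr0.
  by rewrite -det2_sum D0 /det2 !mxE !mul0r subrr ltxx.
Qed.

Lemma sign_changes (D : 'I_n -> R) : \sum_x D x *: xi x = 0 -> (exists x, D x != 0) ->
  exists i j k, (i < j < k)%N /\
    ([/\ 0 < D i, D j < 0 & 0 < D k] \/ [/\ D i < 0, 0 < D j & D k < 0]).
Proof.
move=> D0 [x Dx]; have [m Dm mmin] := @arg_minnP _ x (fun x => D x != 0) (fun x : 'I_n => x : nat) Dx.
have low y : (y < m)%N -> D y = 0.
  by move=> ym; apply/eqP; apply: contraTT ym => /mmin; rewrite -leqNgt.
case: (ltrgtP (D m) 0) Dm => // Dm _.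
  have [||y ym|i [j [k [ijk [h1 h2 h3]]]]] := @sign_changes_pos (fun x => - D x) m.
  - by rewrite -[RHS]oppr0 -[in RHS]D0 -sumrN; apply: eq_bigr => y _; rewrite scaleNr.
  - by rewrite oppr_gt0.
  - by rewrite low // oppr0.
  by exists i, j, k; split=> //; right; split; lra.
have [i [j [k [ijk h]]]] := sign_changes_pos D0 Dm low.
by exists i, j, k; split=> //; left.
Qed.

(** The projection is injective on the union of the faces: otherwise the
    difference of two points has three alternating signs at x < y < z, and the
    faces provide two conforming orders, one with y greatest among them and
    one with y least. *)
Lemma proj_inj i j k l A B : (i < j)%N -> (k < l)%N -> face i j A -> face k l B ->
  proj A = proj B -> A = B.
Proof.
move=> ij kl fA fB E; apply: contrapT => nE.
have H i' j' k' l' (A' B' : 'I_n -> R) x y z : (i' < j')%N -> (k' < l')%N -> face i' j' A' -> face k' l' B' ->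
    (x < y < z)%N -> B' x < A' x -> A' y < B' y -> B' z < A' z -> False.
  move=> ij' kl' fA' fB' /[dup] o /andP[xy yz] hx hy hz.
  have /andP[_ By] := fB'.1 y; have /andP[Ay _] := fA'.1 y.
  have /andP[Bx _] := fB'.1 x; have /andP[_ Ax] := fA'.1 x.
  have /andP[Bz _] := fB'.1 z; have /andP[_ Az] := fA'.1 z.
  have [s cs sb] := face_before ij' fA' (lt_le_trans hy By).
  have [t ct tb] := face_after kl' fB' (le_lt_trans Ay hy).
  have nxy : x != y by rewrite -val_eqE ltn_eqF.
  have nzy : z != y by rewrite -val_eqE gtn_eqF.
  apply: (conforms_separated o ct cs); [apply: tb | apply: tb | apply: sb | apply: sb] => //.
  - exact: lt_le_trans hx Ax.
  - exact: lt_le_trans hz Az.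
  - exact: le_lt_trans Bx hx.
  - exact: le_lt_trans Bz hz.
have D0 : \sum_x (A x - B x) *: xi x = 0.
  rewrite (eq_bigr (fun x => A x *: xi x - B x *: xi x)); last by move=> x _; rewrite scalerBl.
  by rewrite sumrB -/(proj A) -/(proj B) E subrr.
have [|x [y [z [o [[h1 h2 h3]|[h1 h2 h3]]]]]] := sign_changes D0.
- apply: contrapT => no; apply: nE; apply: funext => x; apply: contrapT => /eqP ne.
  by apply: no; exists x; rewrite subr_eq0.
- by apply: (H i j k l A B x y z) => //; lra.
- by apply: (H k l i j B A x y z) => //; lra.
Qed.

Lemma face_vertex i j A : (i < j)%N -> face i j A ->
  (A i == 0) || (A i == 1) -> (A j == 0) || (A j == 1) ->
  proj A \in tile_vertices xi (rank_tile i j).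
Proof.
move=> ij fA; rewrite (proj_face ij fA) !inE.
by case/orP => /eqP->; case/orP => /eqP->; rewrite ?scale0r ?scale1r ?addr0 eqxx ?orbT.
Qed.

Lemma face_edge i j A : (i < j)%N -> face i j A ->
  (A i = 0 -> (A j == 0) || (A j == 1) -> (proj A, i) \in tile_edges xi (rank_tile i j)) /\
  (A j = 0 -> (A i == 0) || (A i == 1) -> (proj A, j) \in tile_edges xi (rank_tile i j)).
Proof.
move=> ij fA; rewrite (proj_face ij fA) !inE.
by split=> ->; case/orP => /eqP->; rewrite ?scale0r ?scale1r ?addr0 eqxx ?orbT.
Qed.

Lemma face_bool i j A x : face i j A -> x != i -> x != j -> (A x == 0) || (A x == 1).
Proof. by move=> [_ H] xi' xj; rewrite H //; case: below; rewrite eqxx ?orbT. Qed.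

(** By injectivity the intersection of two tiles is the projection of the
    intersection of their faces, which is a vertex or an edge. *)
Lemma rank_tiles_meet t t' : t \in rank_tiling -> t' \in rank_tiling -> t != t' ->
  (tile_set xi t `&` tile_set xi t' !=set0)%classic -> meet_properly xi t t'.
Proof.
move=> /mem_rank_tiling[i [j [ij ->]]] /mem_rank_tiling[k [l [kl ->]]] ne [q [tq t'q]].
have nij : i != j by rewrite -val_eqE ltn_eqF.
have nkl : k != l by rewrite -val_eqE ltn_eqF.
have [A fA qA] := (rank_tile_set _ ij).1 tq; have [B fB qB] := (rank_tile_set _ kl).1 t'q.
have EAB : A = B by apply: (proj_inj ij kl fA fB); rewrite -qA.
subst B.
have inter r : (tile_set xi (rank_tile i j) `&` tile_set xi (rank_tile k l))%classic r <->
    exists C, [/\ face i j C, face k l C & r = proj C].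
  split=> [[/(rank_tile_set _ ij)[C fC rC] /(rank_tile_set _ kl)[C' fC' rC']]|[C [fC fC' ->]]].
    by exists C; split=> //; rewrite (proj_inj ij kl fC fC') // -rC.
  by split; [apply/rank_tile_set => //; exists C | apply/rank_tile_set => //; exists C].
have fixedC C x : face i j C -> x != i -> x != j -> C x = A x by move=> [_ H1] h1 h2; rewrite H1 // fA.2.
have fixedC' C x : face k l C -> x != k -> x != l -> C x = A x by move=> [_ H1] h1 h2; rewrite H1 // fB.2.
have nsame : ~ (i = k /\ j = l) by move=> [E1 E2]; move: ne; rewrite E1 E2 eqxx.
case: (pselect (exists a, [/\ (a == i) || (a == j), (a == k) || (a == l) &
    forall x, x != a -> ((x != i) && (x != j)) || ((x != k) && (x != l))])) => [[a [aij akl oth]]|none].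
  right.
  have rest C x : face i j C -> face k l C -> x != a -> C x = A x.
    by move=> fC fC' /oth/orP[]/andP[h1 h2]; [apply: fixedC | apply: fixedC'].
  have bool x : x != a -> (A x == 0) || (A x == 1).
    by move=> /oth/orP[]/andP[h1 h2]; [apply: face_bool fA _ _ | apply: face_bool fB _ _].
  pose Z (r : R) x := if x == a then r else A x.
  have fZ (r : R) (u v : 'I_n) : 0 <= r <= 1 -> (a == u) || (a == v) -> face u v A -> face u v (Z r).
    move=> r01 auv [F1 F2]; split=> x; rewrite /Z; first by case: eqP.
    move=> xu xv; case: eqP => [E|_]; last exact: F2.
    by move: auv; rewrite -E (negbTE xu) (negbTE xv).
  have pZ r : proj (Z r) = proj (Z 0) + r *: xi a.
    rewrite /proj (bigD1 a) //= [in RHS](bigD1 a) //= /Z eqxx scale0r add0r addrC.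
    by congr (_ + _); apply: eq_bigr => x /negbTE->.
  have z01 : 0 <= (0 : R) <= 1 by rewrite lexx ler01.
  have edge (u v : 'I_n) : (u < v)%N -> (a == u) || (a == v) -> face u v A ->
      (proj (Z 0), a) \in tile_edges xi (rank_tile u v).
    move=> uv auv fuv; have fz := fZ 0 u v z01 auv fuv.
    have nuv : u != v by rewrite -val_eqE ltn_eqF.
    have [e1 e2] := face_edge uv fz.
    case/orP: auv => /eqP E; [rewrite E; apply: e1|rewrite E; apply: e2].
    - by rewrite /Z E eqxx.
    - have nva : v != a by rewrite E eq_sym.
      by rewrite /Z (negbTE nva) bool.
    - by rewrite /Z E eqxx.
    - have nua : u != a by rewrite E.
      by rewrite /Z (negbTE nua) bool.
  exists (proj (Z 0), a); split; [exact: edge|exact: edge|].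
  apply/seteqP; split=> r.
    move=> /inter[C [fC fC' ->]]; exists (C a); split; first exact: fC.1.
    rewrite /= -pZ; congr proj; apply: funext => x; rewrite /Z.
    by case: eqP => [->//|/eqP xa]; apply: rest.
  move=> [r0 [r01 ->]]; apply/inter; exists (Z r0); split; [exact: fZ|exact: fZ|by rewrite (pZ r0)].
left; exists (proj A).
have disj x : ((x == i) || (x == j)) -> ((x == k) || (x == l)) -> False.
  move=> h1 h2; apply: none; exists x; split=> // y yx.
  rewrite -!negb_or -negb_and; apply/negP => /andP[h3 h4]; apply: nsame.
  have {}yx := yx; move: h1 h2 h3 h4 yx ij kl.
  by do 4 (case/orP => /eqP ?); subst; rewrite ?eqxx // => _ h5 h6;
     split=> //; move: h5 h6; rewrite ltnNge => /negP h5 /ltnW h6; case: h5.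
have bA x : (A x == 0) || (A x == 1).
  case: (boolP ((x == i) || (x == j))) => [h|]; last first.
    by rewrite negb_or => /andP[h1 h2]; apply: face_bool fA _ _.
  case: (boolP ((x == k) || (x == l))) => [/(disj _ h)//|].
  by rewrite negb_or => /andP[h1 h2]; apply: face_bool fB _ _.
split; [exact: face_vertex|exact: face_vertex|].
apply/seteqP; split=> r.
  move=> /inter[C [fC fC' ->]] /=; congr proj; apply: funext => x.
  case: (boolP ((x == i) || (x == j))) => [h|]; last first.
    by rewrite negb_or => /andP[h1 h2]; apply: fixedC.
  case: (boolP ((x == k) || (x == l))) => [/(disj _ h)//|].
  by rewrite negb_or => /andP[h1 h2]; apply: fixedC'.
by move=> /= ->; apply/inter; exists A.
Qed.

(** The crossings of c that have taken place in s are the first ones for the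
    ranks; d is the last of them, or the first of all crossings of c if there are none. *)
Lemma last_crossing s c : conforms rk s -> (1 < n)%N -> exists2 d, d != c &
  forall x, x != c -> x != d -> inverted s c x = (rk c x < rk c d)%N.
Proof.
move=> cs n1.
have rk_neq x y : x != c -> y != c -> x != y -> rk c x != rk c y.
  rewrite [x == c]eq_sym [y == c]eq_sym => cx cy xy.
  have [lt|lt|E] := ltngtP c y; last by move: cy; rewrite (val_inj E) eqxx.
    by rewrite rk_same_pair // /same_pair eqxx (negbTE xy) (negbTE cy).
  by rewrite (rkC c y) rk_same_pair // /same_pair eqxx (negbTE xy) (negbTE cy).
case: (pickP (fun d => (d != c) && inverted s c d)) => [d0 Pd0|none].
  have [d /andP[dc cd] dmax] := @arg_maxnP _ d0 (fun d => (d != c) && inverted s c d) (rk c) Pd0.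
  exists d => // x xc xd; apply/idP/idP => [cx|lt].
    by rewrite ltn_neqAle rk_neq //; apply: dmax; rewrite xc.
  by apply: (conforms_closed rkP cs _ _ _ lt cd); rewrite // eq_sym.
have [d0 Pd0] : exists d0 : 'I_n, d0 != c.
  have n0 := ltn_trans (ltn0Sn 0) n1.
  have [->|ne] := eqVneq c (Ordinal n0); first by exists (Ordinal n1).
  by exists (Ordinal n0); rewrite eq_sym.
have [d dc dmin] := @arg_minnP _ d0 (fun d => d != c) (rk c) Pd0.
exists d => // x xc xd; have := none x; rewrite xc /= => ->.
by apply/esym/negbTE; rewrite -leqNgt dmin.
Qed.

Lemma prefix_sum_split s c d : d != c ->
  prefix_sum xi s c = (if before s d c then xi d else 0) + \sum_(x | (x != d) && before s x c) xi x.
Proof.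
move=> dc; rewrite /prefix_sum; case: (boolP (before s d c)) => b.
  by rewrite (bigD1 d) //=; congr (_ + _); apply: eq_bigl => x; rewrite andbC.
rewrite add0r; apply: eq_bigl => x; have [->|//] := eqVneq x d.
by rewrite (negbTE b).
Qed.

(** The edge of color c lies on the cd-tile, for the last crossing cd: on its
    right side if the crossing has taken place, on its left side otherwise. *)
Lemma conforms_graph_edge s c : conforms rk s -> graph_edge xi rank_tiling (prefix_sum xi s c, c).
Proof.
move=> cs; have [n1|n1] := eqVneq n 1%N.
  right; split=> //=; apply: prefix_sum_first => x; have -> : x = c; last exact: before_irr.
  by apply: val_inj; have := ltn_ord x; have := ltn_ord c; rewrite /=; move: n1; clear; lia.
have ngt1 : (1 < n)%N by have := ltn_ord c; move: n1; clear; lia.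
have [d dc H] := last_crossing c cs ngt1; left.
have cd : c != d by rewrite eq_sym.
set o := at_rank (rk c d).
have same x : x != d -> before o x c = before s x c.
  move=> xd; have [->|xc] := eqVneq x c; first by rewrite !before_irr.
  have cx : c != x by rewrite eq_sym.
  by rewrite !before_inv !(invertedC _ xc) inverted_at_rank // -H.
have sumE : prefix_sum xi s c = (if before s d c then xi d else 0) + \sum_(x | (x != d) && before o x c) xi x.
  rewrite (prefix_sum_split s dc); congr (_ + _); apply: eq_bigl => x.
  by case: (boolP (x != d)) => //= xd; rewrite same.
have sumO := prefix_sum_split o dc.
have [lt|lt|E] := ltngtP c d; last by move: dc; rewrite (val_inj E) eqxx.
  have [_ ocd _] := at_rank_flips lt; rewrite -/o in ocd.
  have ndc : before o d c = false by rewrite beforeN // ocd.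
  exists (rank_tile c d); first by apply/mem_rank_tiling; exists c, d.
  rewrite /rank_tile -/o !inE sumE sumO ndc add0r; case: ifP => _.
    by rewrite addrC eqxx !orbT.
  by rewrite add0r eqxx.
have fl := at_rank_flips lt; rewrite rkC -/o in fl.
have [Pc _ _ _] := prefix_sum_flips xi fl; have [_ odc _] := fl.
have V : prefix_sum xi o d = \sum_(x | (x != d) && before o x c) xi x.
  by apply: (addIr (xi d)); rewrite -Pc sumO odc addrC.
exists (rank_tile d c); first by apply/mem_rank_tiling; exists d, c.
rewrite /rank_tile rkC -/o !inE sumE V; case: ifP => _.
  by rewrite addrC eqxx !orbT.
by rewrite add0r eqxx !orbT.
Qed.

Lemma flips_rank_tile s a b s' : conforms rk s -> conforms rk s' -> flips s a b s' ->
  rank_tile a b = (prefix_sum xi s a, a, b).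
Proof.
move=> cs cs' fl; have [ab sab E] := fl; have nab : a != b by rewrite -val_eqE ltn_eqF.
have nba : b != a by rewrite eq_sym.
rewrite /rank_tile; congr (_, _, _); apply: eq_bigl => x.
have [->|xa] := eqVneq x a; first by rewrite !before_irr.
have ax : a != x by rewrite eq_sym.
have nsab : inverted s a b = false by rewrite /inverted ab sab.
rewrite !before_inv -!(invertedC _ ax) inverted_at_rank //; congr (_ (+) _).
have [->|xb] := eqVneq x b; first by rewrite ltnn nsab.
have bx : b != x by rewrite eq_sym.
apply/idP/idP => [lt|].
  have : inverted s' a x.
    by apply: (conforms_closed rkP cs' ax xb nab lt); rewrite E // /same_pair !eqxx orbT.
  by rewrite E // /same_pair (negbTE nab) (negbTE xb) andbF orbF.
apply: contraTT; rewrite -leqNgt leq_eqVlt => /orP[|lt].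
  by rewrite eq_sym rk_same_pair // /same_pair (negbTE nab) (negbTE xb) andbF.
by apply/negP => /(conforms_closed rkP cs nab bx ax lt); rewrite nsab.
Qed.

(** At the height of q, some point of the snake lies weakly to the left
    of q. *)
Definition right_of s q := exists c (r : R), [/\ 0 <= r <= 1,
  (prefix_sum xi s c + r *: xi c) 0 1 = q 0 1 & (prefix_sum xi s c + r *: xi c) 0 0 <= q 0 0].

Lemma tile_convex p i j u v q (r : R) : tile_set xi (p, i, j) u -> tile_set xi (p, i, j) v ->
  0 <= r <= 1 -> q = (1 - r) *: u + r *: v -> tile_set xi (p, i, j) q.
Proof.
have H (a b : R) : 0 <= a <= 1 -> 0 <= b <= 1 -> 0 <= r <= 1 -> 0 <= (1 - r) * a + r * b <= 1.
  move=> /andP[a0 a1] /andP[b0 b1] /andP[r0 r1].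
  have q0 : 0 <= 1 - r by rewrite subr_ge0.
  apply/andP; split; first by rewrite addr_ge0 // mulr_ge0.
  rewrite [leRHS](_ : 1 = (1 - r) * 1 + r * 1); last by ring.
  by rewrite lerD // ler_wpM2l.
move=> [a [b [a01 b01 ->]]] [a' [b' [a01' b01' ->]]] r01 ->.
exists ((1 - r) * a + r * a'), ((1 - r) * b + r * b'); split; [exact: H|exact: H|].
by apply: rv2P; rewrite !mxE; ring.
Qed.

Lemma tile_between p i j u v q : tile_set xi (p, i, j) u -> tile_set xi (p, i, j) v ->
  u 0 1 = q 0 1 -> v 0 1 = q 0 1 -> u 0 0 <= q 0 0 -> q 0 0 < v 0 0 -> tile_set xi (p, i, j) q.
Proof.
move=> tu tv uY vY uX vX; have uv : 0 < v 0 0 - u 0 0 by rewrite subr_gt0 (le_lt_trans uX).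
pose r := (q 0 0 - u 0 0) / (v 0 0 - u 0 0).
apply: (tile_convex (r := r) tu tv).
  have uv' : u 0 0 <= v 0 0 by rewrite -subr_ge0 ltW.
  rewrite /r divr_ge0 ?subr_ge0 //=.
  by rewrite ler_pdivrMr // mul1r lerD2r ltW.
apply: rv2P; rewrite !mxE; last by rewrite uY vY; ring.
by rewrite /r; field; exact: lt0r_neq0.
Qed.

Lemma tile_right_boundary p i j (h : R) : (i < j)%N -> 0 <= h <= xi i 0 1 + xi j 0 1 ->
  exists r : R, 0 <= r <= 1 /\
   [\/ (p + r *: xi j) 0 1 = p 0 1 + h | (p + xi j + r *: xi i) 0 1 = p 0 1 + h].
Proof.
move=> ij /andP[h0 h1]; have Yi := xiY_gt0 xiP i; have Yj := xiY_gt0 xiP j.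
have [le|gt] := lerP h (xi j 0 1).
  exists (h / xi j 0 1); split.
    by rewrite divr_ge0 ?(ltW Yj) //= ler_pdivrMr // mul1r.
  by left; rewrite !mxE divfK // lt0r_neq0.
exists ((h - xi j 0 1) / xi i 0 1); split.
  rewrite divr_ge0 ?(ltW Yi) ?subr_ge0 ?(ltW gt) //= ler_pdivrMr // mul1r.
  by rewrite lerBlDr.
by right; rewrite !mxE divfK ?lt0r_neq0 //; ring.
Qed.

(** If q is to the right of s but not of s', then it lies between the left
    and the right sides of the tile over which the snake has moved. *)
Lemma sweep_step s a b s' q : conforms rk s -> conforms rk s' -> flips s a b s' ->
  right_of s q -> right_of s' q \/ exists2 t, t \in rank_tiling & tile_set xi t q.
Proof.
move=> cs cs' fl [c [r [r01 zY zX]]]; have [ab _ _] := fl.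
have [Pb P'b P'a P'x] := prefix_sum_flips xi fl.
case: (pselect (right_of s' q)) => [|nR]; [by left | right].
exists (rank_tile a b); first by apply/mem_rank_tiling; exists a, b.
rewrite (flips_rank_tile cs cs' fl); set p := prefix_sum xi s a in Pb P'b P'a *.
set z := prefix_sum xi s c + r *: xi c in zY zX.
have Ya := xiY_gt0 xiP a; have Yb := xiY_gt0 xiP b.
have /andP[r0 r1] := r01.
have [tz zh] : tile_set xi (p, a, b) z /\ 0 <= z 0 1 - p 0 1 <= xi a 0 1 + xi b 0 1.
  have [ca|ca] := eqVneq c a.
    rewrite /z ca -/p; split.
      by exists r, 0; split; rewrite ?lexx ?ler01 // scale0r addr0.
    rewrite !mxE addrAC subrr add0r mulr_ge0 ?(ltW Ya) //=.
    by rewrite ler_wpDr ?(ltW Yb) // ler_piMl // ltW.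
  have [cb|cb] := eqVneq c b.
    rewrite /z cb Pb; split.
      by exists 1, r; split; rewrite ?lexx ?ler01 // scale1r.
    rewrite !mxE [X in 0 <= X <= _](_ : _ = xi a 0 1 + r * xi b 0 1); last by ring.
    have : 0 <= r * xi b 0 1 <= xi b 0 1 by rewrite mulr_ge0 ?(ltW Yb) //= ler_piMl // ltW.
    by clear Pb P'b P'a P'x; lra.
  by exfalso; apply: nR; exists c, r; rewrite P'x.
have [r' [r'01 [Er|Er]]] := tile_right_boundary p ab zh.
  have vY : (p + r' *: xi b) 0 1 = q 0 1 by rewrite Er -zY; ring.
  apply: (tile_between (v := p + r' *: xi b) tz) => //.
    by exists 0, r'; split; rewrite ?lexx ?ler01 // scale0r addr0.
  by rewrite ltNge; apply/negP => vX; apply: nR; exists b, r'; rewrite P'b.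
have vY : (p + xi b + r' *: xi a) 0 1 = q 0 1 by rewrite Er -zY; ring.
apply: (tile_between (v := p + xi b + r' *: xi a) tz) => //.
  by exists r', 1; split; rewrite ?lexx ?ler01 // scale1r addrAC.
by rewrite ltNge; apply/negP => vX; apply: nR; exists a, r'; rewrite P'a.
Qed.

Lemma sweep s (w : seq 'I_n.-1) (t : 'S_n) q : conforms rk s -> climbs rk s w t -> right_of s q ->
  right_of t q \/ exists2 t, t \in rank_tiling & tile_set xi t q.
Proof.
elim: w s => [|e w IH] s cs /= => [<-|[lt cs' cl] Rs]; first by left.
by have [|] := sweep_step cs cs' (std_flips lt) Rs; [apply: IH | right].
Qed.

Lemma path_height s (y : R) : (0 < n)%N -> 0 <= y <= top_vertex xi 0 1 ->
  exists c (r : R), 0 <= r <= 1 /\ (prefix_sum xi s c + r *: xi c) 0 1 = y.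
Proof.
move=> n0 /andP[y0 y1].
have first : prefix_sum xi s (s (Ordinal n0)) 0 1 <= y.
  by rewrite prefix_sum_first ?mxE // => x; rewrite /before permK.
have [c cy cmax] := @arg_maxnP _ (s (Ordinal n0)) (fun c => prefix_sum xi s c 0 1 <= y)
  (fun c => (s^-1)%g c : nat) first.
have Yc := xiY_gt0 xiP c.
have le : y <= (prefix_sum xi s c + xi c) 0 1.
  have [h|h] := ltnP (((s^-1)%g c).+1) n; last first.
    rewrite prefix_sum_last // => z zc.
    have : (s^-1)%g z != (s^-1)%g c by rewrite (inj_eq perm_inj).
    by rewrite -val_eqE /before /=; have := ltn_ord ((s^-1)%g z); move: h; clear; lia.
  have h' : ((s^-1)%g c < n.-1)%N by move: h; clear; lia.
  pose e := Ordinal h'; have e0 : pos0 e = (s^-1)%g c by apply: val_inj.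
  have ex : s (pos0 e) = c by rewrite e0 permKV.
  have := prefix_sum_next xi s e; rewrite ex => <-.
  rewrite leNgt; apply/negP => /ltW /cmax; rewrite permK pos1E /= ltnn //.
exists c, ((y - prefix_sum xi s c 0 1) / xi c 0 1); split.
  rewrite divr_ge0 ?(ltW Yc) ?subr_ge0 //= ler_pdivrMr // mul1r lerBlDl.
  by move: le; rewrite mxE.
by rewrite !mxE divfK ?lt0r_neq0 // addrC subrK.
Qed.

(** On the left boundary the vector of the current edge supports the
    zonogon. *)
Lemma zonogon_right_of q : (0 < n)%N -> zonogon xi q -> right_of 1%g q.
Proof.
move=> n0 Zq; have [c [r [r01 zY]]] := path_height 1%g n0 (zonogon_height xiP Zq).
exists c, r; split=> //; have [f [f01 Eq]] := Zq.
have Yc := xiY_gt0 xiP c.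
have : det2 (prefix_sum xi 1%g c) (xi c) <= det2 q (xi c).
  rewrite Eq prefix_sumE !det2_sum; apply: ler_sum => x _; rewrite before1.
  have /andP[f0 f1] := f01 x; have [lt|lt|E] := ltngtP x c.
  - by rewrite ler_wnM2r // ltW // det_xi.
  - have Dt := det_xi xiP lt; rewrite mul0r mulr_ge0 //.
    by move: Dt; rewrite /det2; lra.
  - have -> : det2 (xi x) (xi c) = 0 by rewrite (val_inj E) /det2; ring.
    by rewrite !mulr0.
rewrite /det2 -zY !mxE => h; rewrite -(ler_pM2r Yc); clear Eq; lra.
Qed.

(** A point of the zonogon to the right of the right boundary lies on it. *)
Lemma right_of_omega q : (1 < n)%N -> zonogon xi q -> right_of (omega n) q ->
  exists2 t, t \in rank_tiling & tile_set xi t q.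
Proof.
move=> n1 Zq [c [r [r01 zY zX]]]; have [f [f01 Eq]] := Zq.
have Yc := xiY_gt0 xiP c.
have := @det_xi_sum_max _ _ _ xiP (omega n) c f _ f01; rewrite -Eq => /(_ _)h.
have {}h : det2 q (xi c) <= det2 (prefix_sum xi (omega n) c) (xi c).
  by apply: h => d dc; rewrite inverted_omega // eq_sym.
have E : q = prefix_sum xi (omega n) c + r *: xi c.
  apply: rv2P => //; apply: le_anti; rewrite zX andbT.
  move: h; rewrite /det2 -zY !mxE => h; rewrite -(ler_pM2r Yc); clear Eq; lra.
have [[t tT te]|[n1' _]] := conforms_graph_edge c (conforms_omega rkP); last by rewrite n1' in n1.
exists t => //; rewrite E; case: t te {tT} => [[p i] j] te.
have [a [b [-> H]]] := tile_edge_coords r te.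
by exists a, b; split=> //; case: H => -[_ ? ?]; subst; rewrite ?lexx ?ler01.
Qed.

Theorem rank_tiling_tiling : (0 < n)%N -> rhombus_tiling xi rank_tiling.
Proof.
move=> n0; split.
- by move=> p i j /mem_rank_tiling[i' [j' [ij [_ -> ->]]]].
- move=> n1 q; split=> [Zq|[t /mem_rank_tiling[i [j [ij ->]]] /(rank_tile_set _ ij)[A fA ->]]].
    have ngt1 : (1 < n)%N by move: n0 n1; clear; lia.
    have [|w wP] := climb_exists rkP (conforms1 rkP) (conforms_omega rkP).
      by move=> x y _; rewrite inverted1.
    have [Ro|//] := sweep (conforms1 rkP) wP (zonogon_right_of n0 Zq).
    exact: right_of_omega.
  by exists A; split; [exact: fA.1|].
- exact: rank_tiles_meet.
Qed.

Theorem conforms_tiling_domain : (0 < n)%N ->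
  exists D, tiling_domain xi D /\ forall s, conforms rk s -> s \in D.
Proof.
move=> n0; exists [set s | `[< Sigma xi rank_tiling s >]]; split.
  exists rank_tiling; split; first exact: rank_tiling_tiling.
  by move=> s; rewrite inE; split=> /asboolP.
by move=> s cs; rewrite inE; apply/asboolP/SigmaP => c; apply: conforms_graph_edge.
Qed.

End RankingTiling.

(** * Comparison of the maximal sizes *)
Lemma separated_sub_GR_domain n (D : {set 'S_n}) : separated (fun s => s \in D) ->
  exists2 D' : {set 'S_n}, GR_domain D' & D \subset D'.
Proof.
move=> /separated_ranking[rk [rkP DP]].
have [D' [GD' sub]] := conforms_GR_domain rkP.
by exists D' => //; apply/fintype.subsetP => s /DP; apply: sub.
Qed.

Lemma separated_sub_connected_domain n (D : {set 'S_n}) : separated (fun s => s \in D) ->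
  exists D' : {set 'S_n}, [/\ condorcet D', connected_domain D' & D \subset D'].
Proof.
move=> /separated_ranking[rk [rkP DP]].
pose D' := [set s : 'S_n | `[< conforms rk s >]].
have D'P s : s \in D' <-> conforms rk s by rewrite inE; split=> /asboolP.
exists D'; split.
- apply: separated_condorcet.
    by split; apply/D'P; [exact: conforms1 | exact: conforms_omega].
  by move=> i j k ijk s t /D'P cs /D'P ct; apply: conforms_separated ijk _ _ cs ct.
- exact: conforms_connected D'P.
- by apply/fintype.subsetP => s /DP cs; apply/D'P.
Qed.

Lemma card_tiling_domain (R : realType) n (xi : 'I_n -> 'rV[R]_2) (D : {set 'S_n}) :
  tiling_domain xi D -> (#|D| <= gamma xi)%N.
Proof. by move=> TD; rewrite /gamma; apply: leq_bigmax_cond; apply/asboolP. Qed.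

Lemma card_separated_gamma (R : realType) n (xi : 'I_n -> 'rV[R]_2) (D : {set 'S_n}) :
  zonogon_vectors xi -> (1 <= n)%N -> separated (fun s => s \in D) -> (#|D| <= gamma xi)%N.
Proof.
move=> xiP n0 /separated_ranking[rk [rkP DP]].
have [D' [TD' sub]] := conforms_tiling_domain xiP rkP n0.
apply: leq_trans (card_tiling_domain TD'); apply/subset_leq_card.
by apply/fintype.subsetP => s /DP; apply: sub.
Qed.

Theorem mainTheorem4 (R : realType) (n : nat) (n_ge1 : (1 <= n)%N)
    (xi : 'I_n -> 'rV[R]_2) (xiP : zonogon_vectors xi) :
  [<-> forall D : {set 'S_n}, condorcet D -> peak_pit D -> (#|D| <= Phi n)%N;
       forall D : {set 'S_n}, GR_domain D -> (#|D| <= Phi n)%N;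
       forall D : {set 'S_n},
         condorcet D -> connected_domain D -> (#|D| <= Phi n)%N;
       gamma xi = Phi n].
Proof.
tfae=> [H D /GR_domain_separated sep | H D cD kD | H | H D _ /peak_pit_separated[_ sep]].
- have [D' [sub cD' pD']] := separated_peak_pit_hull sep.
  exact: leq_trans (subset_leq_card sub) (H _ cD' pD').
- have [D' GD' sub] := separated_sub_GR_domain (connected_condorcet_separated cD kD).
  exact: leq_trans (subset_leq_card sub) (H _ GD').
- apply/eqP; rewrite eqn_leq; apply/andP; split; last first.
    exact: card_separated_gamma xiP n_ge1 (@fishburn_separated n).
  apply/bigmax_leqP => D /asboolP[T [TP DP]].
  have sep : separated (fun s => s \in D).
    by move=> i j k ijk s t /DP sT /DP tT; apply: (tiling_separated xiP TP ijk sT tT).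
  have [D' [cD' kD' sub]] := separated_sub_connected_domain sep.
  exact: leq_trans (subset_leq_card sub) (H _ cD' kD').
- by rewrite -H; apply: card_separated_gamma.
Qed.
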